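(* Suppose Assumption A holds and Assumption B holds for some $p\ge2$. Define \[ M_p=4\Big(f(x^0)-f_{\mathrm{low}}+p\sigma^2+\frac{3L_1}{2}+\frac{7L_p^2}{(p!)^2}+2\big(p+1+32p^{2p}L_p^2+16(p!)^2\sigma^2\big)\Big). \] Let $\{x^k\}_{k\ge0}$ be generated by Algorithm 1 with $q=p-1$ and, for all $1\le t\le p-1$, $k\ge0$, \[ \eta_k=\frac{1}{(k+p)^{(2p+1)/(3p+1)}},\qquad \gamma_{k,t}=\frac{1}{t(k+p)^{2p/(3p+1)}}, \] \[ \theta_{k,t}=\frac{\prod_{1\le s\le p-1,\,s\neq t}\big(1-s(k+p)^{2p/(3p+1)}\big)}{t(k+p)^{2p/(3p+1)}\prod_{1\le s\le p-1,\,s\neq t}\big((t-s)(k+p)^{2p/(3p+1)}\big)}. \] For $K\ge1$ let $\iota_K$ be drawn uniformly from $\{0,\dots,K-1\}$, independently of the algorithm. Then for every $\epsilon\in(0,1)$, \[ \mathbb{E}[\|\nabla f(x^{\iota_K})\|]\le\epsilon\qquad\text{for all } K\ge\max\Big\{\Big(\frac{(6p+2)M_p}{p\epsilon}\ln\Big(\frac{(6p+2)M_p}{p\epsilon}\Big)\Big)^{(3p+1)/p},\,2p\Big\}, \] where the expectation is over the randomness of the algorithm and of $\iota_K$.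
   Context: Problem: minimize $f:\mathbb{R}^n\to\mathbb{R}$, where only a stochastic gradient estimator $G(\cdot;\xi)$ is accessible, $\xi$ being a random variable with sample space $\Xi$. $\|\cdot\|$ is the Euclidean norm. An empty product equals $1$. Assumption A: (a) there is a finite $f_{\mathrm{low}}$ with $f(x)\ge f_{\mathrm{low}}$ for all $x$; (b) there is $L_1>0$ with $\|\nabla f(y)-\nabla f(x)\|\le L_1\|y-x\|$ for all $x,y$; (c) $\mathbb{E}_\xi[G(x;\xi)]=\nabla f(x)$ and $\mathbb{E}_\xi[\|G(x;\xi)-\nabla f(x)\|^2]\le\sigma^2$ for all $x$, for some $\sigma>0$. Assumption B: $f$ is $p$ times continuously differentiable for some $p\ge2$ and there is $L_p>0$ with $\|D^pf(y)-D^pf(x)\|_{(p)}\le L_p\|y-x\|$ for all $x,y$, where $D^pf(x)$ is the $p$th derivative as a symmetric $p$-linear form and $\|\mathcal{T}\|_{(p)}=\max\{\mathcal{T}[h_1,\dots,h_p]:\|h_i\|\le 1\}$. Algorithm 1 (SFOM with multi-extrapolated momentum): inputs $x^0\in\mathbb{R}^n$, step sizes $\eta_k>0$, an integer $q\ge1$, extrapolation parameters $\gamma_{k,t}\in(0,1)$ and weighting parameters $\theta_{k,t}\in\mathbb{R}$ ($1\le t\le q$, $k\ge0$) with $\sum_{t=1}^q\theta_{k,t}\in(0,1)$ for all $k\ge0$. Initialize $x^{-1}=x^0$, $m^{-1}=0$, $(\gamma_{-1,t},\theta_{-1,t})=(1,1/q)$ for all $t$. For $k=0,1,2,\dots$: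 $z^{k,t}=x^k+\frac{1-\gamma_{k-1,t}}{\gamma_{k-1,t}}(x^k-x^{k-1})$ for $1\le t\le q$; $m^k=(1-\sum_{t=1}^q\theta_{k-1,t})m^{k-1}+\sum_{t=1}^q\theta_{k-1,t}G(z^{k,t};\xi^k)$; $x^{k+1}=x^k-\eta_k m^k/\|m^k\|$. Here $\xi^0,\xi^1,\dots$ are independent samples of $\xi$ (and $m^k\neq0$ is implicitly assumed). *)

(* Defs.v *)
From mathcomp Require Import all_boot all_order all_algebra.
From mathcomp Require Import all_classical all_reals all_analysis.
Set Implicit Arguments. Unset Strict Implicit. Unset Printing Implicit Defensive.
Import Order.TTheory GRing.Theory Num.Theory.
Import numFieldNormedType.Exports.
Local Open Scope classical_set_scope.
Local Open Scope ring_scope.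

Section Defs.
Context {R : realType} {n : nat}.

Definition enorm (v : 'rV[R]_n) : R := Num.sqrt (\sum_(i < n) v ord0 i ^+ 2).

Definition basis_vec (i : 'I_n) : 'rV[R]_n := delta_mx ord0 i.

Definition grad (f : 'rV[R]_n -> R) (x : 'rV[R]_n) : 'rV[R]_n :=
  \row_(i < n) 'D_(basis_vec i) f x.

(* Iterated directional derivative:
   dirD f [:: h_1; ...; h_k] x = D^k f(x)[h_1,...,h_k]. *)
Fixpoint dirD (f : 'rV[R]_n -> R) (hs : seq 'rV[R]_n) : 'rV[R]_n -> R :=
  match hs with
  | [::] => f
  | h :: hs' => fun x => 'D_h (dirD f hs') x
  end.

Definition Cp (p : nat) (f : 'rV[R]_n -> R) : Prop :=
  forall hs : seq 'rV[R]_n, (size hs <= p)%N ->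
    (forall x : 'rV[R]_n, {for x, continuous (dirD f hs)}) /\
    ((size hs < p)%N -> forall (x h : 'rV[R]_n), derivable (dirD f hs) x h).

Definition AssumptionA {d} {Xi : measurableType d}
    (f : 'rV[R]_n -> R) (G : 'rV[R]_n -> Xi -> 'rV[R]_n)
    (mu : probability Xi R) (flow L1 sigma : R) : Prop :=
  (forall x, flow <= f x) /\
  0 < L1 /\
  (forall x y, enorm (grad f y - grad f x) <= L1 * enorm (y - x)) /\
  0 < sigma /\
  (forall x (i : 'I_n),
      mu.-integrable setT (fun xi => (G x xi ord0 i)%:E) /\
      (\int[mu]_xi (G x xi ord0 i)%:E = (grad f x ord0 i)%:E)%E) /\
  (forall x, (\int[mu]_xi ((enorm (G x xi - grad f x)) ^+ 2)%:E
              <= (sigma ^+ 2)%:E)%E).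

(* Assumption B:  f is C^p and
   ||D^p f(y) - D^p f(x)||_(p) <= Lp ||y - x||, where
   ||T||_(p) = max { T[h_1..h_p] : ||h_i|| <= 1 }  (unfolded). *)
Definition AssumptionB (p : nat) (f : 'rV[R]_n -> R) (Lp : R) : Prop :=
  (2 <= p)%N /\ Cp p f /\ 0 < Lp /\
  forall (x y : 'rV[R]_n) (hs : seq 'rV[R]_n),
    size hs = p -> all (fun h => enorm h <= 1) hs ->
    dirD f hs y - dirD f hs x <= Lp * enorm (y - x).

(* Joint measurability of G in (x, xi) (implicit in the paper, needed for
   E_xi[G(x;xi)] and for the iterates to be random variables). Stated
   without a sigma-algebra on R^n: G composed with any measurable
   (x, xi)-valued map is measurable. *)
Definition G_measurable {d} {Xi : measurableType d}
    (G : 'rV[R]_n -> Xi -> 'rV[R]_n) : Prop :=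
  forall dT (T : measurableType dT) (X : T -> 'rV[R]_n) (Y : T -> Xi),
    (forall i, measurable_fun setT (fun t => X t ord0 i)) ->
    measurable_fun setT Y ->
    forall i, measurable_fun setT (fun t => G (X t) (Y t) ord0 i).

(* Algorithm 1 run on a sample path s : nat -> Xi (s k = xi^k).
   gam k t, theta k t are gamma_{k,t}, theta_{k,t} for k >= 0, 1 <= t <= q;
   the conventions gamma_{-1,t} = 1, theta_{-1,t} = 1/q are built in. *)
Section Algo.
Context {Xi : Type} (G : 'rV[R]_n -> Xi -> 'rV[R]_n) (x0 : 'rV[R]_n)
  (eta : nat -> R) (q : nat) (gam theta : nat -> nat -> R).

Definition gam_prev (k t : nat) : R := if k is k'.+1 then gam k' t else 1.
Definition theta_prev (k t : nat) : R :=
  if k is k'.+1 then theta k' t else (q%:R)^-1.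

(* state after k steps: (x^k, x^{k-1}, m^{k-1}) *)
Fixpoint sfom_state (s : nat -> Xi) (k : nat)
    : 'rV[R]_n * 'rV[R]_n * 'rV[R]_n :=
  match k with
  | 0 => (x0, x0, 0)
  | k'.+1 =>
    let: (xk, xkm1, mkm1) := sfom_state s k' in
    let z t := xk + ((1 - gam_prev k' t) / gam_prev k' t) *: (xk - xkm1) in
    let mk := (1 - \sum_(1 <= t < q.+1) theta_prev k' t) *: mkm1
              + \sum_(1 <= t < q.+1) theta_prev k' t *: G (z t) (s k') in
    (xk - (eta k' / enorm mk) *: mk, xk, mk)
  end.

Definition sfom_x (s : nat -> Xi) (k : nat) : 'rV[R]_n := (sfom_state s k).1.1.
Definition sfom_m (s : nat -> Xi) (k : nat) : 'rV[R]_n := (sfom_state s k.+1).2.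
End Algo.

Definition eta_p (p k : nat) : R :=
  ((k + p)%:R `^ ((2 * p + 1)%:R / (3 * p + 1)%:R))^-1.
Definition pw_p (p k : nat) : R := (k + p)%:R `^ ((2 * p)%:R / (3 * p + 1)%:R).
Definition gam_p (p k t : nat) : R := (t%:R * pw_p p k)^-1.
Definition theta_p (p k t : nat) : R :=
  (\prod_(1 <= s < p | s != t) (1 - s%:R * pw_p p k)) /
  (t%:R * pw_p p k * \prod_(1 <= s < p | s != t) ((t%:R - s%:R) * pw_p p k)).

Definition M_p (p : nat) (fx0 flow sigma L1 Lp : R) : R :=
  4 * (fx0 - flow + p%:R * sigma ^+ 2 + 3 * L1 / 2
       + 7 * Lp ^+ 2 / (p`!)%:R ^+ 2
       + 2 * (p%:R + 1 + 32 * p%:R ^+ (2 * p) * Lp ^+ 2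
              + 16 * (p`!)%:R ^+ 2 * sigma ^+ 2)).

End Defs.

(* Main.v *)
(**
With [x^{k+1} - x^k = eta_k h], [h] a unit vector, the points [z^{k+1,t}] are
[x^k + (t w_k) eta_k h] with [w_k = (k+p)^(2p/(3p+1))], and the weights [theta_{k,t}] are the
values at 1 of the Lagrange basis polynomials of the nodes [0, w_k, 2 w_k, ..., (p-1) w_k].  The
momentum recursion therefore reproduces exactly the Taylor polynomial of degree [p-1] of the
gradient along [h], and the bias of the error [m^k - grad f(x^k)] is a Taylor remainder of order
[eta_k^p w_k^(p-1)].  Conditioning on the past (Fubini) gives
[e_{k+1} <= (1 - 1/w_k) e_k + D/w_k^2] for the mean square error, where
[D = 4 p^(2p) L_p^2 + (p!)^2 sigma^2].

Weighting [e_k] by [(k+p)^((p-1)/(3p+1))] makes this recursion telescope against the descent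
inequality of a normalized gradient step, and every remaining term is of order [1/(k+p)], so
[sum_{k<K} eta_k E|grad f(x^k)|] is at most a constant times [ln K].  As [eta_k] is at least
[K^(-(2p+1)/(3p+1)) / 2], the average of the expected gradient norms is of order
[K^(-p/(3p+1)) ln K].
*)
Require Import Defs.
From HB Require Import structures.
From mathcomp Require Import all_boot all_order all_algebra.
From mathcomp Require Import all_classical all_reals all_analysis.
From mathcomp Require Import measurable_realfun ring lra zify.
Import Order.TTheory GRing.Theory Num.Theory.
Import numFieldNormedType.Exports.
Local Open Scope classical_set_scope.
Local Open Scope ring_scope.

(** * Euclidean geometry and Taylor bounds *)

(** The exponents come from a balance. In units of [b = (k+p)^(1/(3p+1))], one has [w = b^(2p)],
    [eta = b^-(2p+1)] and the weight of the squared error is [pot = b^(p-1)]. Against a contraction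
    by [1 - 1/w], the squared bias [(eta^p w^(p-1))^2] costs an extra factor [w], which makes it
    [1/w^2], the order of the squared noise. With this choice [pot / w^2] and the Young term
    [eta^2 w / pot] are both exactly [1/(k+p)].

    Two obstacles shape the rest. Smoothness is given through iterated directional derivatives, so
    the bias is paired with a unit vector and becomes a one-variable Taylor estimate along a line.
    Independence is given by product formulas over finitely many samples, so conditioning needs the
    sigma-algebra of the first [k] samples, a pi-system argument, and measurability of iterates and
    gradients with respect to it. Integrability of the squared errors and of the gradient norms is
    derived along the way. *)

Section EuclideanNorm.
Context {R : realType} {n : nat}.
Implicit Types (u v w : 'rV[R]_n) (a : R).

Definition dot u v : R := \sum_(i < n) u ord0 i * v ord0 i.

Lemma dotC u v : dot u v = dot v u.
Proof. by apply: eq_bigr => i _; rewrite mulrC. Qed.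

Lemma dotDl u v w : dot (u + v) w = dot u w + dot v w.
Proof. by rewrite /dot -big_split; apply: eq_bigr => i _; rewrite mxE mulrDl. Qed.

Lemma dotZl a u v : dot (a *: u) v = a * dot u v.
Proof. by rewrite /dot mulr_sumr; apply: eq_bigr => i _; rewrite mxE mulrA. Qed.

Lemma dotNl u v : dot (- u) v = - dot u v.
Proof. by rewrite -scaleN1r dotZl mulN1r. Qed.

Lemma dotBl u v w : dot (u - v) w = dot u w - dot v w.
Proof. by rewrite dotDl dotNl. Qed.

Lemma dotDr u v w : dot w (u + v) = dot w u + dot w v.
Proof. by rewrite dotC dotDl !(dotC w). Qed.

Lemma dotZr a u v : dot u (a *: v) = a * dot u v.
Proof. by rewrite dotC dotZl dotC. Qed.

Lemma dotNr u v : dot u (- v) = - dot u v.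
Proof. by rewrite dotC dotNl dotC. Qed.

Lemma dotBr u v w : dot w (u - v) = dot w u - dot w v.
Proof. by rewrite dotDr dotNr. Qed.

Lemma dot0l v : dot 0 v = 0.
Proof. by rewrite -(scale0r v) dotZl mul0r. Qed.

Lemma dot_suml (I : Type) (r : seq I) (P : pred I) (F : I -> 'rV[R]_n) v :
  dot (\sum_(i <- r | P i) F i) v = \sum_(i <- r | P i) dot (F i) v.
Proof.
by elim/big_rec2: _ => [|i y x _ <-]; rewrite ?dot0l // dotDl.
Qed.

Lemma dot_ge0 v : 0 <= dot v v.
Proof. by apply: sumr_ge0 => i _; rewrite -expr2 sqr_ge0. Qed.

Lemma enormE v : enorm v = Num.sqrt (dot v v).
Proof. by []. Qed.

Lemma enorm_ge0 v : 0 <= enorm v.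
Proof. exact: sqrtr_ge0. Qed.

Lemma enorm_sq v : enorm v ^+ 2 = dot v v.
Proof. by rewrite enormE sqr_sqrtr ?dot_ge0. Qed.

Lemma enormZ a v : enorm (a *: v) = `|a| * enorm v.
Proof. by rewrite !enormE dotZl dotZr mulrA -expr2 sqrtrM ?sqr_ge0// sqrtr_sqr. Qed.

Lemma enormN v : enorm (- v) = enorm v.
Proof. by rewrite -scaleN1r enormZ normrN1 mul1r. Qed.

Lemma enorm0 : enorm (0 : 'rV[R]_n) = 0.
Proof. by rewrite enormE dot0l sqrtr0. Qed.

Lemma enorm_eq0 v : (enorm v == 0) = (v == 0).
Proof.
apply/idP/idP => [|/eqP->]; last by rewrite enorm0.
rewrite sqrtr_eq0 => v0; apply/eqP/rowP => i; rewrite mxE; apply/eqP.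
rewrite -sqrf_eq0 eq_le sqr_ge0 andbT.
apply: le_trans v0; rewrite (bigD1 i) //= lerDl.
by apply: sumr_ge0 => j _; rewrite sqr_ge0.
Qed.

Lemma dot_le_enorm u v : dot u v <= enorm u * enorm v.
Proof.
have [/eqP|u0] := boolP (enorm u == 0).
  by rewrite (rwP eqP) enorm_eq0 => /eqP ->; rewrite dot0l enorm0 mul0r.
have [/eqP|v0] := boolP (enorm v == 0).
  by rewrite (rwP eqP) enorm_eq0 => /eqP ->; rewrite dotC dot0l enorm0 mulr0.
have := dot_ge0 (enorm u *: v - enorm v *: u).
have uv0 : 0 < enorm u * enorm v by rewrite mulr_gt0 // lt0r ?u0 ?v0 enorm_ge0.
rewrite dotBl !dotBr !dotZl !dotZr -!enorm_sq (dotC v u) => H.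
by rewrite -(ler_pM2l uv0); nra.
Qed.

Lemma enormD u v : enorm (u + v) <= enorm u + enorm v.
Proof.
rewrite -(ler_pXn2r (ltn0Sn 1)) ?nnegrE ?addr_ge0 ?enorm_ge0 //.
rewrite enorm_sq dotDl !dotDr -!enorm_sq (dotC v u).
by have := dot_le_enorm u v; nra.
Qed.

Lemma enormB u v : enorm (u - v) <= enorm u + enorm v.
Proof. by rewrite -(enormN v) enormD. Qed.

Lemma enorm_sum (I : Type) (r : seq I) (P : pred I) (F : I -> 'rV[R]_n) :
  enorm (\sum_(i <- r | P i) F i) <= \sum_(i <- r | P i) enorm (F i).
Proof.
elim/big_rec2: _ => [|i y x _ h]; first by rewrite enorm0.
by apply: (le_trans (enormD _ _)); rewrite lerD2l.
Qed.

Lemma enorm_normalize v : v != 0 -> enorm ((enorm v)^-1 *: v) = 1.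
Proof.
move=> v0; rewrite enormZ ger0_norm ?invr_ge0 ?enorm_ge0 // mulVf //.
by rewrite enorm_eq0.
Qed.

(** Duality reduces a bound on a vector to bounds on scalars such as [dot (grad f _) u], to which
    one-variable calculus applies. *)
Lemma enorm_le_of_dot v a : 0 <= a ->
  (forall u, enorm u = 1 -> dot v u <= a) -> enorm v <= a.
Proof.
move=> a0 h; have [->|v0] := eqVneq v 0; first by rewrite enorm0.
have := h _ (enorm_normalize v v0).
by rewrite dotZr -enorm_sq expr2 mulrA mulVf ?mul1r // enorm_eq0.
Qed.

Lemma sqr_sum_le (I : Type) (r : seq I) (c x : I -> R) :
  (forall i, 0 <= c i) ->
  (\sum_(i <- r) c i * x i) ^+ 2 <=
  (\sum_(i <- r) c i) * \sum_(i <- r) c i * x i ^+ 2.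
Proof.
move=> c0; elim: r => [|j r IH]; first by rewrite !big_nil expr0n mulr0.
rewrite !big_cons; move: IH.
set S := \sum_(i <- r) c i * x i; set A := \sum_(i <- r) c i.
set B := \sum_(i <- r) _ * _ ^+ 2 => IH.
have A0 : 0 <= A by apply: sumr_ge0.
have B0 : 0 <= B by apply: sumr_ge0 => i _; rewrite mulr_ge0 ?sqr_ge0.
have cj := c0 j.
have T0 : 0 <= B + A * x j ^+ 2 by rewrite addr_ge0 // mulr_ge0 ?sqr_ge0.
(* The square of the cross term is at most [4 A B x_j^2], hence at most [(B + A x_j^2)^2]. *)
have xS : 2 * x j * S <= B + A * x j ^+ 2.
  apply: le_trans (ler_norm _) _.
  rewrite -(ler_pXn2r (ltn0Sn 1)) ?nnegrE // real_normK ?num_real //.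
  have := ler_wpM2l (sqr_ge0 (x j)) IH.
  by have := sqr_ge0 (B - A * x j ^+ 2); nra.
by have := ler_wpM2l cj xS; nra.
Qed.

(** Meant for the noise terms of one momentum step, which share a single sample and so are not
    orthogonal in mean; the weights enter through the sum of their absolute values. *)
Lemma sqr_enorm_comb (I : Type) (r : seq I) (c : I -> R) (F : I -> 'rV[R]_n) :
  enorm (\sum_(i <- r) c i *: F i) ^+ 2 <=
  (\sum_(i <- r) `|c i|) * \sum_(i <- r) `|c i| * enorm (F i) ^+ 2.
Proof.
apply: le_trans (sqr_sum_le _ _ _ _ (fun i => normr_ge0 (c i))).
have S0 : 0 <= \sum_(i <- r) `|c i| * enorm (F i).
  by apply: sumr_ge0 => i _; rewrite mulr_ge0 ?enorm_ge0.
rewrite ler_pXn2r ?nnegrE ?enorm_ge0 //.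
apply: le_trans (enorm_sum _ _ _ _) _.
by apply: ler_sum => i _; rewrite enormZ.
Qed.

End EuclideanNorm.

(** * One-variable Taylor polynomials and remainders *)

Section Taylor.
Context {R : realType}.
Implicit Types (phi : nat -> R -> R) (L s t : R).

(** [phi r] plays the role of the [r]-th derivative of [phi 0]. The value is a [{poly R}] so that
    polynomial interpolation applies to it. *)
Definition taylor_poly (m : nat) phi : {poly R} :=
  \poly_(r < m.+1) (phi r 0 / r`!%:R).

Lemma deriv_taylor_poly m phi :
  (taylor_poly m.+1 phi)^`() = taylor_poly m (fun r => phi r.+1).
Proof.
apply/polyP => i; rewrite coef_deriv !coef_poly ltnS.
case: ifP => _; last by rewrite mul0rn.
rewrite -mulr_natr factS natrM; field.
by rewrite (addrC 1) natr1 !pnatr_eq0 -lt0n fact_gt0.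
Qed.

Lemma taylor_poly0 m phi : (taylor_poly m phi).[0] = phi 0%N 0.
Proof. by rewrite horner_coef0 coef_poly /= fact0 divr1. Qed.

(** Induction on the order: the derivative of the difference to be bounded is the same difference
    for the shifted family, and the mean value theorem transfers its sign. *)
Lemma taylor_upper (m : nat) phi L s :
  (forall r t, (r < m)%N -> is_derive t 1 (phi r) (phi r.+1 t)) ->
  (forall t, 0 <= t -> phi m t - phi m 0 <= L * t) -> 0 <= s ->
  phi 0%N s - (taylor_poly m phi).[s] <= L / m.+1`!%:R * s ^+ m.+1.
Proof.
elim: m phi s => [|m IH] phi s dphi Lphi s0.
  have -> : taylor_poly 0 phi = (phi 0%N 0)%:P.
    apply/polyP => i; rewrite coef_poly coefC; case: i => //=.
    by rewrite fact0 divr1.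
  by rewrite hornerC divr1 expr1 Lphi.
pose Q : {poly R} := taylor_poly m.+1 phi + (L / m.+2`!%:R) *: 'X^(m.+2).
pose dQ (t : R) := phi 1%N t - (taylor_poly m (fun r => phi r.+1)).[t]
   - L / m.+1`!%:R * t ^+ m.+1.
have dg t : is_derive t 1 (phi 0%N - horner Q) (dQ t).
  have := dphi 0%N t isT => ?.
  apply: is_derive_eq.
  rewrite /Q derivD deriv_taylor_poly derivZ derivXn hornerD hornerZ hornerMn.
  rewrite hornerXn /dQ /= opprD addrA; congr (_ - _).
  rewrite factS natrM invfM -[X in _ * X = _]mulr_natr /=.
  have : (m.+2%:R : R) != 0 by rewrite pnatr_eq0.
  have : (m.+1`!%:R : R) != 0 by rewrite pnatr_eq0 -lt0n fact_gt0.
  by move: (m.+2%:R : R) (_`!%:R : R) => a b b0 a0; field; rewrite a0 b0.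
have cg : {within `[0, s], continuous (phi 0%N - horner Q)}.
  apply: continuous_subspaceT => t.
  by apply: differentiable_continuous; apply/derivable1_diffP; case: (dg t).
have [c c0s] := MVT_segment s0 (fun t _ => dg t) cg.
rewrite /= !fctE subr0 => E.
have Q0 : phi 0%N 0 - Q.[0] = 0.
  by rewrite /Q hornerD hornerZ hornerXn expr0n mulr0 addr0 taylor_poly0 subrr.
move: E; rewrite Q0 subr0 /Q hornerD hornerZ hornerXn opprD addrA => E.
rewrite -subr_le0 E mulr_le0_ge0 // /dQ subr_le0.
apply: IH; last by move: c0s; rewrite in_itv /= => /andP[].
- by move=> r t rm; exact: dphi.
- by move=> t t0; exact: Lphi.
Qed.

Lemma taylor_bound (m : nat) phi L s :
  (forall r t, (r < m)%N -> is_derive t 1 (phi r) (phi r.+1 t)) ->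
  (forall t, 0 <= t -> `|phi m t - phi m 0| <= L * t) -> 0 <= s ->
  `|phi 0%N s - (taylor_poly m phi).[s]| <= L / m.+1`!%:R * s ^+ m.+1.
Proof.
move=> dphi Lphi s0; rewrite ler_norml lerNl; apply/andP; split; last first.
  by apply: taylor_upper => // t t0; exact: le_trans (ler_norm _) (Lphi t t0).
have := @taylor_upper m (fun r t => - phi r t) L s.
have -> : taylor_poly m (fun r t => - phi r t) = - taylor_poly m phi.
  apply/polyP => i; rewrite coefN !coef_poly; case: ifP => _; rewrite ?oppr0 //.
  by rewrite mulNr.
rewrite hornerN => H.
have -> : - (phi 0%N s - (taylor_poly m phi).[s]) =
    - phi 0%N s - - (taylor_poly m phi).[s] by rewrite opprK opprB addrC.
apply: H => //.
- move=> r t rm; have ? := dphi r t rm.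
  exact: is_deriveN.
- move=> t t0; rewrite opprK addrC; apply: le_trans (Lphi t t0).
  by rewrite distrC ler_norm.
Qed.

End Taylor.

(** * Directional derivatives and the gradient *)

Section DirectionalDerivative.
Context {R : realType} {n : nat}.
Implicit Types (f g : 'rV[R]_n -> R) (x y h u v : 'rV[R]_n).

Lemma is_derive_line g x h (s : R) : derivable g (x + s *: h) h ->
  is_derive s 1 (fun t : R => g (x + t *: h)) ('D_h g (x + s *: h)).
Proof.
move=> dg.
have E : (fun t : R => t^-1 *: (((fun t : R => g (x + t *: h)) \o shift s) (t *: 1)
      - g (x + s *: h))) =
    (fun t : R => t^-1 *: ((g \o shift (x + s *: h)) (t *: h) - g (x + s *: h))).
  apply/funext => t /=; congr (_ *: (g _ - _)).
  by rewrite [t *: 1]mulr1 scalerDl addrCA.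
by split; rewrite /derivable /derive E.
Qed.

Lemma derive_MVT g x h : (forall y, derivable g y h) ->
  exists2 c : R, 0 <= c <= 1 & g (x + h) - g x = 'D_h g (x + c *: h).
Proof.
move=> dg; pose F (t : R) := g (x + t *: h).
have dF (t : R) : is_derive t 1 F ('D_h g (x + t *: h)) by exact: is_derive_line.
have cF : {within `[0, 1], continuous F}.
  apply: continuous_subspaceT => t.
  by apply: differentiable_continuous; apply/derivable1_diffP; case: (dF t).
have [c c01] := MVT_segment ler01 (fun t _ => dF t) cF.
rewrite /F scale1r scale0r addr0 subr0 mulr1 => ->.
by exists c => //; move: c01; rewrite in_itv.
Qed.

Lemma deriveZdir g x h (a : R) : derivable g x h ->
  derivable g x (a *: h) /\ 'D_(a *: h) g x = a * 'D_h g x.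
Proof.
move=> dg.
have dl : is_derive (a * 0 : R) 1 (fun t : R => g (x + t *: h)) ('D_h g x).
  by have := @is_derive_line g x h 0; rewrite mulr0 scale0r addr0; exact.
have da : is_derive (0 : R) 1 (fun t : R => a * t) a.
  by apply: is_derive_eq; rewrite [_ *: _]mulr1.
have := is_derive1_comp dl da; set C := _ \o _ => -[d1 d2].
have E : (fun t : R => t^-1 *: ((C \o shift (0 : R)) (t *: (1 : R)) - C 0)) =
    (fun t : R => t^-1 *: ((g \o shift x) (t *: (a *: h)) - g x)).
  apply/funext => t; rewrite /C /=.
  by rewrite mulr0 scale0r !addr0 [t *: 1]mulr1 scalerA (mulrC t) (addrC x).
by split; [rewrite /derivable -E | rewrite /derive -E -[RHS]mulrC].
Qed.

(** The increment along [u + v] is split at [x + t u]. By the mean value theorem the second piece is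
    a derivative along [v] at a point near [x], and continuity of ['D_v g] gives its limit. *)
Lemma deriveDdir g x u v : (forall y h, derivable g y h) ->
  {for x, continuous ('D_v g)} -> 'D_(u + v) g x = 'D_u g x + 'D_v g x.
Proof.
move=> dg cv; rewrite [RHS]addrC.
apply: cvg_lim => //.
have cu : t^-1 *: (g (t *: u + x) - g x) @[t --> (0 : R)^'] --> 'D_u g x.
  exact: (dg x u).
suff cq : t^-1 *: (g (t *: (u + v) + x) - g (t *: u + x)) @[t --> (0 : R)^']
    --> 'D_v g x.
  apply: (cvg_trans _ (cvgD cq cu)); apply: near_eq_cvg; near=> t => /=.
  by rewrite /= !fctE -scalerDr addrA subrK.
apply/cvgrPdist_lt => e e0.
have /cvgrPdist_lt/(_ e e0) := cv; rewrite nearE => /nbhs_ballP[r /= r0 rP].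
have K0 : 0 < `|u| + `|v| + 1 by rewrite ltr_wpDl ?addr_ge0.
near=> t.
have t0 : t != 0 by near: t; exact: nbhs_dnbhs_neq.
have tr : `|t| * (`|u| + `|v| + 1) < r.
  rewrite -ltr_pdivlMr //; near: t.
  by apply: dnbhs0_lt; rewrite divr_gt0.
have [c /andP[c0 c1] cE] := @derive_MVT g (t *: u + x) (t *: v) (fun y => dg y _).
have -> : t *: (u + v) + x = t *: u + x + t *: v by rewrite scalerDr addrAC.
rewrite cE; have [_ ->] := @deriveZdir g (t *: u + x + c *: (t *: v)) v t (dg _ _).
rewrite [_^-1 *: _]mulrA mulVf // mul1r; apply: rP => /=.
rewrite -ball_normE /= addrAC opprD addrCA subrr addr0 normrN.
apply: le_lt_trans tr; apply: le_trans (ler_normD _ _) _.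
rewrite !normrZ (ger0_norm c0).
have := normr_ge0 t; have := mulr_ge0 (normr_ge0 t) (normr_ge0 v).
by move: (`|t|) (`|u|) (`|v|) => a b b' ? ?; nra.
Unshelve. all: by end_near. Qed.

Lemma derive_grad g x u : (forall y h, derivable g y h) ->
  (forall h, continuous ('D_h g)) -> 'D_u g x = dot (grad g x) u.
Proof.
move=> dg cg; rewrite {1}(row_sum_delta u) /dot.
elim/big_rec2: _ => [|i y h _ <-]; first by rewrite derive0.
rewrite deriveDdir //; last exact: cg.
by have [_ ->] := @deriveZdir g x (basis_vec i) (u ord0 i) (dg _ _); rewrite mxE mulrC.
Qed.

End DirectionalDerivative.

(** * Extrapolation weights and rates *)

Section Extrapolation.
Context {R : realType}.

(** [theta_p p k] is convertible to [extrap_weight p (pw_p p k)], so bounds for a free [w] apply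
    directly to the algorithm. *)
Definition extrap_weight (p : nat) (w : R) (t : nat) : R :=
  (\prod_(1 <= s < p | s != t) (1 - s%:R * w)) /
  (t%:R * w * \prod_(1 <= s < p | s != t) ((t%:R - s%:R) * w)).

Lemma prod_nat_geq1 (p t : nat) (F : nat -> R) : (0 < t)%N ->
  \prod_(0 <= s < p.+1 | s != t) F s =
  F 0%N * \prod_(1 <= s < p.+1 | s != t) F s.
Proof. by move=> t0; rewrite big_ltn_cond // eq_sym -lt0n t0. Qed.

(* Lagrange interpolation at the nodes [0, w, 2 w, ..., (p - 1) w], evaluated at 1. *)
Lemma extrapolation_exact (p : nat) (w : R) (P : {poly R}) :
  (0 < p)%N -> 0 < w -> (size P <= p)%N ->
  (\prod_(1 <= s < p) (1 - (s%:R * w)^-1)) * P.[0] +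
  \sum_(1 <= t < p) extrap_weight p w t * P.[t%:R * w] = P.[1].
Proof.
case: p => // q _ w0 sP.
pose x (j : nat) : R := j%:R * w.
have xinj : injective x.
  by move=> i j /(mulIf (lt0r_neq0 w0)) /eqP; rewrite eqr_nat => /eqP.
pose l (i : nat) : R := \prod_(0 <= j < q.+1 | j != i) (1 - x j) /
  \prod_(0 <= j < q.+1 | j != i) (x i - x j).
have -> : P.[1] = \sum_(0 <= i < q.+1) l i * P.[x i].
  rewrite {1}(lagrange_gen (ltn0Sn q) xinj sP) horner_sum big_mkord.
  apply: eq_bigr => i _; rewrite hornerM hornerC lagrangeE // hornerM hornerC.
  rewrite mulrC; congr (_ * _); rewrite mulrC !horner_prod /l !big_mkord.
  by congr (_ / _); apply: eq_bigr => j _; rewrite hornerXsubC.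
have x0 : x 0%N = 0 by rewrite /x mul0r.
(* The basis polynomial of node 0, evaluated at 1, is the product of the factors
   [(1 - s w) / (0 - s w) = 1 - 1/(s w)]. *)
rewrite [in RHS]big_ltn // x0; congr (_ * _ + _).
  have E (F : nat -> R) :
      \prod_(0 <= j < q.+1 | j != 0%N) F j = \prod_(1 <= j < q.+1) F j.
    rewrite big_ltn_cond //= [LHS]big_nat_cond [RHS]big_nat_cond.
    by apply: eq_bigl => -[|j] //=; rewrite !andbT.
  rewrite /l !E x0 -prodf_div; apply: eq_big_nat => s /andP[s1 _].
  have s0 : (s%:R : R) != 0 by rewrite pnatr_eq0 -lt0n.
  by rewrite /x; field; rewrite s0 lt0r_neq0.
apply: eq_big_nat => t /andP[t0 tq]; congr (_ * _).
rewrite /l !prod_nat_geq1 // /extrap_weight.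
rewrite x0 !subr0 mul1r; congr (_ / (_ * _)).
by apply: eq_bigr => s _; rewrite mulrBl.
Qed.

(** Each numerator factor is at most [s w] because [s w >= 1], each denominator factor is at least
    [w], and the denominator has one factor more. *)
Lemma extrap_weight_le (p t : nat) (w : R) : (0 < t < p)%N -> 1 <= w ->
  `|extrap_weight p w t| <= p.-1`!%:R / w.
Proof.
move=> /andP[t0 tp] w1; have w0 : 0 < w by apply: lt_le_trans w1.
set W : R := \prod_(1 <= s < p | s != t) w.
have W0 : 0 < W by apply: prodr_gt0.
have num : `|\prod_(1 <= s < p | s != t) (1 - s%:R * w)| <= p.-1`!%:R * W.
  rewrite normr_prod; apply: (@le_trans _ _ (\prod_(1 <= s < p | s != t) (s%:R * w))).
    rewrite big_nat_cond [leRHS]big_nat_cond.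
    apply: ler_prod => s /andP[/andP[s1 _] _]; rewrite normr_ge0 /=.
    have : 1 <= s%:R * w by apply: mulr_ege1 => //; rewrite ler1n.
    by move=> sw; rewrite ler_norml; nra.
  rewrite big_split /= ler_wpM2r ?(ltW W0) //.
  have p0 : (0 < p)%N by apply: leq_ltn_trans tp.
  rewrite fact_prod prednK // natr_prod [leRHS](bigID (fun s => s != t)) /=.
  rewrite ler_peMr ?prodr_ge0 //.
  rewrite big_nat_cond; elim/big_ind: _ => [|y z|s /andP[/andP[s1 _] _]] //.
    exact: mulr_ege1.
  by rewrite ler1n.
have den : w * W <= `|t%:R * w * \prod_(1 <= s < p | s != t) ((t%:R - s%:R) * w)|.
  rewrite normrM normr_prod normrM (gtr0_norm w0) normr_nat.
  apply: ler_pM; rewrite ?(ltW w0) ?(ltW W0) //.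
    by rewrite ler_peMl ?ler1n ?(ltW w0).
  apply: ler_prod => s st; rewrite (ltW w0) normrM (gtr0_norm w0) ler_peMl ?(ltW w0) //.
  case: (ltngtP s t) st => // h _; last rewrite distrC.
    by rewrite -natrB ?(ltnW h) // normr_nat ler1n subn_gt0.
  by rewrite -natrB ?(ltnW h) // normr_nat ler1n subn_gt0.
rewrite /extrap_weight normrM normfV.
have wW : 0 < w * W by rewrite mulr_gt0.
rewrite ler_pdivrMr; last exact: lt_le_trans den.
apply: (le_trans num); rewrite -[leRHS]mulrA ler_wpM2l //.
by rewrite ler_pdivlMl.
Qed.

Lemma sum_extrap_weight_le (p : nat) (w : R) : (0 < p)%N -> 1 <= w ->
  \sum_(1 <= t < p) `|extrap_weight p w t| <= p`!%:R / w.
Proof.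
case: p => // q _ w1; have w0 : 0 < w by apply: lt_le_trans w1.
apply: (@le_trans _ _ (\sum_(1 <= t < q.+1) (q`!%:R / w))).
  by rewrite !big_nat; apply: ler_sum => t tq; apply: extrap_weight_le.
rewrite sumr_const_nat subn1 /= -[leLHS]mulr_natl mulrA -natrM ler_wpM2r ?invr_ge0 ?(ltW w0) //.
by rewrite ler_nat factS leq_mul2r leqnSn orbT.
Qed.

(** The left side is the total weight of the Taylor remainders in the bias, in units of [eta^p]: 1
    for the target point and [(t w)^p] for each node. The smallness of the weights saves one power
    of [w]. *)
Lemma sum_extrap_weight_pow_le (p : nat) (w : R) : (0 < p)%N -> 1 <= w ->
  1 + \sum_(1 <= t < p) `|extrap_weight p w t| * (t%:R * w) ^+ p <=
  2 * p%:R ^+ p * p`!%:R * w ^+ p.-1.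
Proof.
case: p => // q _ w1; have w0 : 0 < w by apply: lt_le_trans w1.
have H : \sum_(1 <= t < q.+1) `|extrap_weight q.+1 w t| * (t%:R * w) ^+ q.+1 <=
    q.+1%:R ^+ q.+1 * q.+1`!%:R * w ^+ q.
  have -> : q.+1%:R ^+ q.+1 * q.+1`!%:R * w ^+ q =
     q.+1`!%:R / w * (q.+1%:R * w) ^+ q.+1.
    by rewrite exprMn [w ^+ q.+1]exprS; field; rewrite lt0r_neq0.
  apply: (@le_trans _ _ (\sum_(1 <= t < q.+1)
      `|extrap_weight q.+1 w t| * (q.+1%:R * w) ^+ q.+1)).
    rewrite !big_nat; apply: ler_sum => t /andP[_ tq]; rewrite ler_wpM2l //.
    rewrite lerXn2r ?nnegrE ?mulr_ge0 ?(ltW w0) //.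
    by rewrite ler_wpM2r ?(ltW w0) // ler_nat ltnW.
  rewrite -mulr_suml ler_wpM2r ?exprn_ge0 ?mulr_ge0 ?(ltW w0) //.
  exact: sum_extrap_weight_le.
have H1 : (1:R) <= q.+1%:R ^+ q.+1 * q.+1`!%:R * w ^+ q.
  rewrite mulr_ege1 ?exprn_ege1 // mulr_ege1 ?exprn_ege1 ?ler1n ?fact_gt0 //.
by rewrite /=; lra.
Qed.

(** The factor [s = 1] is exactly [1 - 1/w] and the others lie in [[0, 1]]. This is the contraction
    of the error recursion. *)
Lemma momentum_weight_bounds (p : nat) (w : R) : (1 < p)%N -> 1 <= w ->
  0 <= \prod_(1 <= s < p) (1 - (s%:R * w)^-1) <= 1 - w^-1.
Proof.
move=> p1 w1; have w0 : 0 < w by apply: lt_le_trans w1.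
have sw s : (1 <= s)%N -> 0 <= 1 - (s%:R * w)^-1 <= 1.
  move=> s1; have sw0 : 0 < s%:R * w by rewrite mulr_gt0 // ltr0n.
  have : (s%:R * w)^-1 <= 1.
    by rewrite invf_le1 // mulr_ege1 // ler1n.
  have : 0 <= (s%:R * w)^-1 by rewrite invr_ge0 ltW.
  by move=> ? ?; apply/andP; split; lra.
apply/andP; split.
  by rewrite big_nat; apply: prodr_ge0 => s /andP[/sw/andP[]].
rewrite big_ltn // mul1r ler_piMr //.
  by have /andP[] := sw 1%N isT; rewrite mul1r.
set B := \prod_(_ <= _ < _) _; suff /andP[] : 0 <= B <= 1 by [].
rewrite /B big_nat; elim/big_ind: _ => [|x y|s /andP[s1 _]].
- by rewrite ler01 lexx.
- move=> /andP[x0 x1] /andP[y0 y1].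
  by rewrite mulr_ge0 //= mulr_ile1.
- by apply: sw; apply: ltnW.
Qed.

End Extrapolation.

(** * Rates, potential and logarithmic estimates *)

Section Rates.
Context {R : realType}.
Implicit Types (a b c e : R).

Lemma powR_frac a (m N : nat) : 0 <= a ->
  a `^ (m%:R / N%:R) = (a `^ (N%:R^-1)) ^+ m.
Proof. by move=> a0; rewrite mulrC powRrM powR_mulrn ?powR_ge0. Qed.

(** All rates are integer powers of this root or of its inverse, so identities between them reduce
    to arithmetic of natural exponents. *)
Definition root_p (p k : nat) : R := (k + p)%:R `^ ((3 * p + 1)%:R^-1).
(* Weight of the squared error in the potential. *)
Definition pot_p (p k : nat) : R := root_p p k ^+ p.-1.

Lemma eta_pE p k : eta_p p k = (root_p p k ^+ (2 * p + 1))^-1 :> R.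
Proof. by rewrite /eta_p powR_frac. Qed.

Lemma pw_pE p k : pw_p p k = root_p p k ^+ (2 * p) :> R.
Proof. by rewrite /pw_p powR_frac. Qed.

Lemma natE_root_p p k : (k + p)%:R = root_p p k ^+ (3 * p + 1).
Proof.
by rewrite /root_p -powR_mulrn ?powR_ge0 // -powRrM mulVf ?powRr1 //.
Qed.

Lemma root_p_ge1 p k : (1 < p)%N -> 1 <= root_p p k.
Proof.
move=> p1; rewrite -[leLHS](powRr0 (k + p)%:R) ler_powR ?invr_ge0 //.
by rewrite ler1n addn_gt0 (ltnW p1) orbT.
Qed.

Lemma root_p_gt0 p k : (1 < p)%N -> 0 < root_p p k.
Proof. by move=> p1; apply: lt_le_trans (root_p_ge1 p k p1). Qed.

Lemma pw_p_ge1 p k : (1 < p)%N -> 1 <= pw_p p k :> R.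
Proof. by move=> p1; rewrite pw_pE exprn_ege1 // root_p_ge1. Qed.

Lemma pw_p_gt0 p k : (1 < p)%N -> 0 < pw_p p k :> R.
Proof. by move=> p1; apply: lt_le_trans (pw_p_ge1 p k p1). Qed.

Lemma pw_p_le p k : (1 < p)%N -> pw_p p k <= (k + p)%:R :> R.
Proof.
move=> p1; rewrite pw_pE natE_root_p ler_weXn2l ?root_p_ge1 //.
by rewrite (mulnDl 2 1) mul1n -addnA leq_addr.
Qed.

Lemma pot_p_gt0 p k : (1 < p)%N -> 0 < pot_p p k.
Proof. by move=> p1; rewrite exprn_gt0 // root_p_gt0. Qed.

Lemma eta_p_gt0 p k : (1 < p)%N -> 0 < eta_p p k :> R.
Proof. by move=> p1; rewrite eta_pE invr_gt0 exprn_gt0 // root_p_gt0. Qed.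

Lemma pot_pw_p p k : (1 < p)%N -> pot_p p k / pw_p p k ^+ 2 = ((k + p)%:R)^-1.
Proof.
move=> p1; rewrite natE_root_p pw_pE /pot_p -exprM.
have b0 := root_p_gt0 p k p1; move: (root_p p k) b0 => b b0.
have -> : (2 * p * 2 = p.-1 + (3 * p + 1))%N by case: p p1 => // q _ /=; lia.
by rewrite exprD invfM mulVKf // lt0r_neq0 // exprn_gt0.
Qed.

Lemma eta_sqr_pw_p p k : (1 < p)%N ->
  eta_p p k ^+ 2 * pw_p p k / pot_p p k = ((k + p)%:R)^-1.
Proof.
move=> p1; rewrite natE_root_p pw_pE eta_pE /pot_p exprVn -exprM.
have b0 := root_p_gt0 p k p1; move: (root_p p k) b0 => b b0.
have -> : ((2 * p + 1) * 2 = 2 * p + 2 * p + 2)%N by lia.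
have -> : (3 * p + 1 = p.-1 + (2 * p + 2))%N by case: p p1 => // q _ /=; lia.
rewrite -(addnA (2 * p)%N) !(exprD b (2 * p)%N) !(exprD b p.-1) !(exprD b (2 * p)%N).
have bn n : b ^+ n != 0 by rewrite lt0r_neq0 // exprn_gt0.
have := bn (2 * p)%N; have := bn p.-1; have := bn 2%N.
move: (b ^+ (2 * p)) (b ^+ p.-1) (b ^+ 2) => X Y Z Z0 Y0 X0.
by field; rewrite X0 Y0 Z0.
Qed.

Lemma eta_sqr_le p k : (1 < p)%N -> eta_p p k ^+ 2 <= ((k + p)%:R)^-1 :> R.
Proof.
move=> p1; rewrite natE_root_p eta_pE exprVn -exprM.
have b0 := root_p_gt0 p k p1.
rewrite lef_pV2 ?posrE ?exprn_gt0 // ler_weXn2l ?root_p_ge1 //; lia.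
Qed.

(** The last factor [w] on the left is what the convexity inequality in [sfom_drift_le] charges for
    a bias against the contraction [1 - 1/w]. *)
Lemma bias_rate p k : (1 < p)%N ->
  (eta_p p k ^+ p * pw_p p k ^+ p.-1) ^+ 2 * pw_p p k = (pw_p p k ^+ 2)^-1 :> R.
Proof.
move=> p1; rewrite pw_pE eta_pE exprVn -!exprM.
have b0 := root_p_gt0 p k p1; move: (root_p p k) b0 => b b0.
have -> : ((2 * p + 1) * p = 2 * p * p.-1 + 3 * p)%N.
  by case: p p1 => // q _ /=; nia.
have bn n : b ^+ n != 0 by rewrite lt0r_neq0 // exprn_gt0.
have -> : b ^- (2 * p * p.-1 + 3 * p) * b ^+ (2 * p * p.-1) = b ^- (3 * p).
  by rewrite exprD; field; rewrite !bn.
rewrite exprVn -exprM.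
have -> : (3 * p * 2 = 2 * p * 2 + 2 * p)%N by lia.
by rewrite (exprD b (2 * p * 2)%N) invfM -mulrA mulVf // mulr1.
Qed.

Lemma pot_p0_le p : (1 < p)%N -> pot_p p 0 <= p%:R.
Proof.
move=> p1; rewrite -{2}[p]add0n natE_root_p ler_weXn2l ?root_p_ge1 //.
by case: p p1 => // q _ /=; lia.
Qed.

(* [pot_p p k = (k + p) `^ r] with [r <= 1/2], and [1 + x <= (1 + x / 2) ^ 2]. *)
Lemma pot_pS_le p k : (1 < p)%N ->
  pot_p p k.+1 <= pot_p p k * (1 + ((k + p)%:R)^-1 / 2).
Proof.
move=> p1; set a : R := (k + p)%:R.
have a0 : 0 < a by rewrite ltr0n addn_gt0 (ltnW p1) orbT.
have i0 : 0 < a^-1 by rewrite invr_gt0.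
have E j : pot_p p j = (j + p)%:R `^ (p.-1%:R / (3 * p + 1)%:R) by rewrite powR_frac.
rewrite !E.
have -> : (k.+1 + p)%:R = a * (1 + a^-1).
  by rewrite mulrDr mulr1 divff ?lt0r_neq0 // addSn -natr1.
rewrite powRM ?(ltW a0) ?addr_ge0 ?(ltW i0) // ler_wpM2l ?powR_ge0 //.
apply: (@le_trans _ _ ((1 + a^-1) `^ (2^-1))).
  rewrite ler_powR ?lerDl ?(ltW i0) //.
  rewrite ler_pdivrMr ?ltr0n ?addn1 // ler_pdivlMl //.
  by rewrite -natrM ler_nat; case: p p1 {a a0 i0 E} => // q _ /=; lia.
rewrite powR12_sqrt ?addr_ge0 ?(ltW i0) //.
rewrite -(ler_pXn2r (ltn0Sn 1)) ?nnegrE ?sqrtr_ge0 //; last first.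
  by rewrite addr_ge0 // divr_ge0 // ltW.
by rewrite sqr_sqrtr ?addr_ge0 ?(ltW i0) //; nra.
Qed.

(** The weight grows by a relative amount of at most [1/(2(k+p)) <= 1/(2w)], which uses up half of
    the contraction [1/w]; the other half is the summand on the left. *)
Lemma potential_sum p (e : nat -> R) (E0 D : R) (K : nat) : (1 < p)%N ->
  (forall k, 0 <= e k) -> 0 <= D -> e 0%N <= E0 ->
  (forall k, e k.+1 <= (1 - (pw_p p k)^-1) * e k + D / pw_p p k ^+ 2) ->
  \sum_(k < K) 2^-1 * (pot_p p k / pw_p p k) * e k <=
  p%:R * E0 + 3 / 2 * D * \sum_(k < K) ((k + p)%:R)^-1.
Proof.
move=> p1 e0 D0 eE0 eS.
(* The final potential is kept on the left so that the induction closes. *)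
suff : \sum_(k < K) 2^-1 * (pot_p p k / pw_p p k) * e k + pot_p p K * e K <=
    p%:R * E0 + 3 / 2 * D * \sum_(k < K) ((k + p)%:R)^-1.
  by apply: le_trans; rewrite lerDl mulr_ge0 // ltW // pot_p_gt0.
elim: K => [|K IH].
  rewrite !big_ord0 mulr0 add0r addr0 ler_pM ?pot_p0_le //.
  by rewrite ltW // pot_p_gt0.
rewrite !big_ord_recr /=.
have := eS K; have := pot_pS_le p K p1; have := pot_pw_p p K p1.
have := pw_p_le p K p1; have := pw_p_ge1 p K p1.
have := pot_p_gt0 p K p1; have := pot_p_gt0 p K.+1 p1; have := e0 K.
have : (2 : R) <= (K + p)%:R by rewrite ler_nat (leq_trans p1) ?leq_addl.
move: IH; set S1 := \sum_(_ < _) _; set S2 := \sum_(_ < _) _.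
move: (pot_p p K) (pot_p p K.+1) (pw_p p K : R) ((K + p)%:R : R) (e K) (e K.+1).
move=> q q' w a x x' IH a2 x0 q'0 q0 w1 wa qw qq' xx'.
have w0 : 0 < w by lra.
have a0 : 0 < a by lra.
have wi : 0 < w^-1 by rewrite invr_gt0.
have wi1 : w^-1 <= 1 by rewrite invf_le1.
have ai : 0 < a^-1 by rewrite invr_gt0.
have aw : a^-1 <= w^-1 by rewrite lef_pV2.
have qa : q * (w^-1 ^+ 2) = a^-1 by rewrite exprVn.
have h1 : q' * x' <= q' * ((1 - w^-1) * x + D * w^-1 ^+ 2).
  by rewrite ler_wpM2l ?(ltW q'0) // exprVn.
have h2 : q' * (1 - w^-1) <= q * (1 - w^-1 / 2).
  apply: le_trans (_ : q * (1 + a^-1 / 2) * (1 - w^-1) <= _).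
    by rewrite ler_wpM2r // subr_ge0.
  rewrite -mulrA ler_pM2l //.
  by have := mulr_ge0 (ltW ai) (ltW wi); nra.
(* The factor [3/2] bounds the growth [1 + 1/(2(K+p))] of the weight. *)
have h3 : q' * w^-1 ^+ 2 <= 3 / 2 * a^-1.
  apply: (@le_trans _ _ (q * (1 + a^-1 / 2) * w^-1 ^+ 2)).
    by rewrite ler_wpM2r // sqr_ge0.
  rewrite mulrAC qa mulrC ler_wpM2r ?(ltW ai) //.
  have : a^-1 <= 1 by rewrite invf_le1 //; lra.
  lra.
have h4 := ler_wpM2l D0 h3; have h5 := ler_wpM2r x0 h2.
move: IH h1 h4 h5; rewrite mulrDr.
move: (w^-1) (a^-1) => wi' ai'.
by move=> IH h1 h4 h5; nra.
Qed.

Lemma ln_ge1 (K : nat) : (4 <= K)%N -> 1 <= ln (K%:R : R).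
Proof.
move=> K4; apply: (@le_trans _ _ (ln (4 : R))); last first.
  by rewrite ler_ln ?posrE ?ltr0n ?ler_nat // (leq_trans _ K4).
(* [ln (1 + x) <= x] at [x = -1/2] gives [ln 2 >= 1/2]. *)
have := @le_ln1Dx R (- 2^-1); rewrite (_ : 1 + - 2^-1 = 2^-1 :> R); last by field.
rewrite lnV ?posrE // => h.
have -> : (4 : R) = 2 * 2 by ring.
by rewrite lnM ?posrE //; have := h (_ : -1 < - 2^-1); lra.
Qed.

(** With [a = k + p], each term is at most [ln a - ln (a - 1)]; after telescoping,
    [K + p - 1 <= K^2] is used. *)
Lemma harmonic_le p K : (1 < p)%N -> (2 * p <= K)%N ->
  \sum_(k < K) ((k + p)%:R)^-1 <= 2 * ln (K%:R : R).
Proof.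
move=> p1 pK.
have h m : \sum_(k < m) ((k + p)%:R)^-1 <= ln ((m + p).-1%:R : R) - ln (p.-1%:R).
  elim: m => [|m IH]; first by rewrite big_ord0 add0n subrr.
  rewrite big_ord_recr addSn /=; set a : R := (m + p)%:R.
  have a1 : 1 < a by rewrite ltr1n; lia.
  have a0 : 0 < a by apply: lt_trans a1.
  have E : (m + p).-1%:R = a * (1 + - a^-1).
    by rewrite mulrDr mulr1 mulrN divff ?lt0r_neq0 // -subn1 natrB //; lia.
  have i1 : a^-1 < 1 by rewrite invf_lt1.
  have i0 : 0 < 1 + - a^-1 by rewrite subr_gt0.
  move: IH; rewrite E lnM ?posrE //.
  have := @le_ln1Dx R (- a^-1) (_ : _); rewrite ltrN2 => /(_ i1).
  by lra.
apply: (le_trans (h K)); apply: (@le_trans _ _ (ln ((K + p).-1%:R : R))).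
  by rewrite lerBlDr lerDl ln_ge0 // ler1n; lia.
have K0 : 0 < K%:R :> R by rewrite ltr0n; lia.
have Kp : 0 < (K + p).-1%:R :> R by rewrite ltr0n; lia.
rewrite mulr_natl -lnXn // ler_ln ?posrE ?exprn_gt0 //.
by rewrite -natrX ler_nat; nia.
Qed.

(** Write [ln u = ln c + ln (u / c)]: the hypothesis bounds the first part, sublinearity of [ln] the
    second. *)
Lemma complexity_ln (c u : R) : 0 < c -> 0 < u -> c * ln c <= u ->
  c * ln u <= 2 * u.
Proof.
move=> c0 u0 cu.
have v0 : 0 < u / c by rewrite divr_gt0.
have -> : ln u = ln c + ln (u / c) by rewrite -lnM ?posrE // mulrC divfK // lt0r_neq0.
have := ln_sublinear v0; rewrite ltr_pdivlMr // => h.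
by rewrite mulrDr; nra.
Qed.

(** This is [complexity_ln] for [u = K^(p/(3p+1))]; the factor [p/(3p+1)] turns [ln K] into
    [ln u]. *)
Lemma complexity p K (c : R) : (1 < p)%N -> (0 < K)%N -> 0 < c ->
  (c * ln c) `^ ((3 * p + 1)%:R / p%:R) <= K%:R ->
  c * ln (K%:R : R) * p%:R / (3 * p + 1)%:R <= 2 * (K%:R `^ ((3 * p + 1)%:R^-1)) ^+ p.
Proof.
move=> p1 K0 c0 cK.
have K0' : 0 < K%:R :> R by rewrite ltr0n.
have p0 : 0 < p%:R :> R by rewrite ltr0n ltnW.
have N0 : 0 < (3 * p + 1)%:R :> R by rewrite ltr0n addn1.
rewrite -powR_frac ?ler0n //; set u := K%:R `^ _.
have u0 : 0 < u by rewrite powR_gt0.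
have -> : c * ln (K%:R : R) * p%:R / (3 * p + 1)%:R = c * ln u.
  by rewrite /u ln_powR; field; rewrite lt0r_neq0.
apply: complexity_ln => //.
(* Inverting the real power needs a positive base; otherwise the bound holds by sign. *)
have [cl|cl] := leP (c * ln c) 0; first by apply: le_trans cl (ltW u0).
have -> : c * ln c = ((c * ln c) `^ ((3 * p + 1)%:R / p%:R)) `^ (p%:R / (3 * p + 1)%:R).
  rewrite -powRrM.
  have -> : (3 * p + 1)%:R / p%:R * (p%:R / (3 * p + 1)%:R) = 1 :> R.
    by field; rewrite !lt0r_neq0.
  by rewrite powRr1 // ltW.
by apply: ge0_ler_powR => //; rewrite ?nnegrE ?powR_ge0 ?ler0n //.
Qed.

End Rates.

(** * Bias and descent *)

Section SmoothSteps.
Set Implicit Arguments. Unset Strict Implicit.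
Context {R : realType} {n : nat}.
Implicit Types (f : 'rV[R]_n -> R) (x h u v : 'rV[R]_n).

Lemma Cp_derivable p f : (0 < p)%N -> Cp p f -> forall x h, derivable f x h.
Proof. by move=> p0 /(_ [::] isT)[_ /(_ p0)]. Qed.

Lemma Cp_derive_grad p f x u : (0 < p)%N -> Cp p f ->
  'D_u f x = dot (grad f x) u.
Proof.
move=> p0 Cf; apply: derive_grad; first exact: Cp_derivable Cf.
by move=> h y; have [+ _] := Cf [:: h] p0; apply.
Qed.

(** Interpolation cancels the Taylor polynomials at all points at once, so only remainders survive,
    and the one at [x] itself is zero. *)
Lemma bias_le p f (Lp w eta : R) x h : AssumptionB p f Lp ->
  1 <= w -> 0 <= eta -> enorm h = 1 ->
  enorm ((\prod_(1 <= s < p) (1 - (s%:R * w)^-1)) *: grad f x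
    + \sum_(1 <= t < p) extrap_weight p w t *: grad f (x + (t%:R * w * eta) *: h)
    - grad f (x + eta *: h))
  <= Lp / p`!%:R * eta ^+ p *
     (1 + \sum_(1 <= t < p) `|extrap_weight p w t| * (t%:R * w) ^+ p).
Proof.
move=> [p2 [Cf [Lp0 fL]]] w1 eta0 h1.
have p0 : (0 < p)%N by apply: ltnW.
have w0 : 0 < w by apply: lt_le_trans w1.
have rhs0 : 0 <= Lp / p`!%:R * eta ^+ p *
     (1 + \sum_(1 <= t < p) `|extrap_weight p w t| * (t%:R * w) ^+ p).
  rewrite mulr_ge0 ?mulr_ge0 ?exprn_ge0 ?invr_ge0 ?(ltW Lp0) //.
  rewrite addr_ge0 ?sumr_ge0 // => t _.
  by rewrite mulr_ge0 ?exprn_ge0 ?mulr_ge0 ?(ltW w0).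
apply: enorm_le_of_dot => // u u1.
(* [dirD] differentiates along the last vector of the list first. With [u] in that place, [phi r.+1]
   is the derivative of [phi r] along [h] without exchanging any derivatives. *)
pose phi (r : nat) (s : R) := dirD f (nseq r h ++ [:: u]) (x + s *: h).
have phi0 s : phi 0%N s = dot (grad f (x + s *: h)) u.
  by rewrite /phi /= (Cp_derive_grad _ _ p0 Cf).
have dphi r (t : R) : (r < p.-1)%N -> is_derive t 1 (phi r) (phi r.+1 t).
  move=> rp; apply: is_derive_line.
  have sz : (size (nseq r h ++ [:: u]) < p)%N.
    by rewrite size_cat size_nseq addn1 -ltn_predRL.
  by have [_ /(_ sz)] := Cf _ (ltnW sz).
have Lphi t : 0 <= t -> `|phi p.-1 t - phi p.-1 0| <= Lp * t.
  move=> t0.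
  have sz : size (nseq p.-1 h ++ [:: u]) = p by rewrite size_cat size_nseq addn1 prednK.
  have al : all (fun h => enorm h <= 1) (nseq p.-1 h ++ [:: u]).
    by rewrite all_cat all_nseq h1 lexx orbT /= u1 lexx.
  have e1 : enorm (t *: h) = t by rewrite enormZ h1 mulr1 ger0_norm.
  rewrite /phi scale0r addr0 ler_norml lerNl opprB; apply/andP; split.
    have := fL (x + t *: h) x _ sz al.
    by rewrite opprD addNKr enormN e1.
  have := fL x (x + t *: h) _ sz al.
  by rewrite (addrC x) addrK e1.
pose T := taylor_poly p.-1 phi.
have Tbnd s : 0 <= s -> `|phi 0%N s - T.[s]| <= Lp / p`!%:R * s ^+ p.
  by move=> s0; have := taylor_bound _ _ _ _ dphi Lphi s0; rewrite prednK.
(* Rescaling by [eta] turns the nodes [t w eta] and the target [eta] into [t w] and 1. *)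
pose P := T \Po (eta *: 'X).
have PE a : P.[a] = T.[eta * a] by rewrite horner_comp hornerZ hornerX.
have sP : (size P <= p)%N.
  apply: (leq_trans (size_comp_poly_leq _ _)).
  have sT : (size T <= p)%N by rewrite -(prednK p0); exact: size_poly.
  have sX : (size (eta *: 'X : {poly R}) <= 2)%N.
    by apply: leq_trans (size_scale_leq _ _) _; rewrite size_polyX.
  have : ((size T).-1 * (size (eta *: 'X : {poly R})).-1 <= p.-1 * 1)%N.
    by apply: leq_mul; lia.
  lia.
have := extrapolation_exact _ _ _ p0 w0 sP; rewrite !PE mulr0 mulr1.
rewrite {1}/T taylor_poly0.
under [X in _ + X = _ -> _]eq_bigr do rewrite PE.
move=> E.
pose r s := phi 0%N s - T.[s].
have -> : dot ((\prod_(1 <= s < p) (1 - (s%:R * w)^-1)) *: grad f x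
    + \sum_(1 <= t < p) extrap_weight p w t *: grad f (x + (t%:R * w * eta) *: h)
    - grad f (x + eta *: h)) u =
    \sum_(1 <= t < p) extrap_weight p w t * r (eta * (t%:R * w)) - r eta.
  rewrite dotBl dotDl dotZl dot_suml /r -E phi0.
  rewrite -{1}(addr0 x) -{1}(scale0r h) -phi0.
  under [X in _ + X - _ = _]eq_bigr do rewrite dotZl -phi0 (mulrC _ eta).
  under [X in _ = X - _]eq_bigr do rewrite mulrBr.
  by rewrite sumrB -phi0; ring.
apply: le_trans (ler_norm _) _; apply: le_trans (ler_normB _ _) _.
rewrite addrC mulrDr mulr1 lerD ?Tbnd //.
apply: le_trans (ler_norm_sum _ _ _) _; rewrite mulr_sumr.
apply: ler_sum => t _; rewrite normrM [leRHS]mulrCA ler_wpM2l // -[leRHS]mulrA -exprMn.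
by apply: Tbnd; rewrite !mulr_ge0 // ltW.
Qed.

Lemma descent p f (L1 eta : R) x h : (1 < p)%N -> Cp p f ->
  (forall x y, enorm (grad f y - grad f x) <= L1 * enorm (y - x)) ->
  0 <= eta -> enorm h = 1 ->
  f (x + eta *: h) <= f x + eta * dot (grad f x) h + L1 / 2 * eta ^+ 2.
Proof.
move=> p1 Cf fL eta0 h1; have p0 := ltnW p1.
pose phi (r : nat) (s : R) := dirD f (nseq r h) (x + s *: h).
have dphi r (t : R) : (r < 1)%N -> is_derive t 1 (phi r) (phi r.+1 t).
  by case: r => // _; apply: is_derive_line; exact: Cp_derivable Cf _ _.
have Lphi t : 0 <= t -> phi 1%N t - phi 1%N 0 <= L1 * t.
  move=> t0; rewrite /phi /= !(Cp_derive_grad _ _ p0 Cf) -dotBl.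
  apply: le_trans (dot_le_enorm _ _) _; rewrite h1 mulr1.
  apply: le_trans (fL _ _) _.
  by rewrite scale0r addr0 (addrC x) addrK enormZ h1 mulr1 ger0_norm.
have := taylor_upper _ _ _ _ dphi Lphi eta0.
rewrite /taylor_poly horner_poly !big_ord_recl big_ord0 /= /phi /=.
rewrite scale0r addr0 (Cp_derive_grad _ _ p0 Cf).
rewrite /bump /= fact0 !divr1 expr0 expr1 mulr1 addr0 (_ : 2`! = 2)%N //.
lra.
Qed.

Lemma normalized_step p f (L1 eta : R) x m : (1 < p)%N -> Cp p f ->
  (forall x y, enorm (grad f y - grad f x) <= L1 * enorm (y - x)) ->
  0 <= eta -> m != 0 ->
  eta * enorm (grad f x) <= f x - f (x - (eta / enorm m) *: m) +
    2 * eta * enorm (m - grad f x) + L1 / 2 * eta ^+ 2.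
Proof.
move=> p1 Cf fL eta0 m0.
set g := grad f x; set e := enorm (m - g).
have em : 0 < enorm m by rewrite lt0r enorm_eq0 m0 enorm_ge0.
pose h := - ((enorm m)^-1 *: m).
have h1 : enorm h = 1 by rewrite enormN enorm_normalize.
have -> : x - (eta / enorm m) *: m = x + eta *: h by rewrite scalerN scalerA.
have := @descent p f L1 eta x h p1 Cf fL eta0 h1.
(* The inner product of [g] with [m/|m|] is [|m|] minus that of [m - g], hence at least [|m| - e];
   and [|m| >= |g| - e]. *)
have gh : dot g h <= 2 * e - enorm g.
  have -> : dot g h = dot (m - g) ((enorm m)^-1 *: m) - enorm m.
    rewrite /h dotNr dotBl !dotZr -enorm_sq expr2 mulKf ?lt0r_neq0 //; ring.
  have := dot_le_enorm (m - g) ((enorm m)^-1 *: m).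
  rewrite enorm_normalize // mulr1 -/e.
  have := enormB m (m - g); rewrite opprB addrC subrK -/e.
  lra.
have := ler_wpM2l eta0 gh; rewrite -/g; lra.
Qed.

End SmoothSteps.

(** * Independence and expectations *)

Section MeasurableVectors.
Set Implicit Arguments. Unset Strict Implicit.
Context {R : realType} {n : nat} {dT : measure_display} {T : measurableType dT}.
Implicit Types X Y : T -> 'rV[R]_n.

(** Coordinatewise, the form in which [G_measurable] takes its input and gives its output. *)
Definition measurable_vec X := forall i, measurable_fun setT (fun t => X t ord0 i).

Lemma measurable_vec_cst (v : 'rV[R]_n) : measurable_vec (fun=> v).
Proof. by move=> i; exact: measurable_cst. Qed.

Lemma measurable_vecD X Y : measurable_vec X -> measurable_vec Y ->
  measurable_vec (fun t => X t + Y t).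
Proof.
move=> mX mY i; under eq_fun do rewrite mxE.
exact: measurable_funD.
Qed.

Lemma measurable_vecZ (g : T -> R) X : measurable_fun setT g ->
  measurable_vec X -> measurable_vec (fun t => g t *: X t).
Proof.
move=> mg mX i; under eq_fun do rewrite mxE.
exact: measurable_funM.
Qed.

Lemma measurable_vecB X Y : measurable_vec X -> measurable_vec Y ->
  measurable_vec (fun t => X t - Y t).
Proof.
move=> mX mY i; under eq_fun do rewrite !mxE.
exact: measurable_funB.
Qed.

Lemma measurable_vec_sum (I : Type) (r : seq I) (F : I -> T -> 'rV[R]_n) :
  (forall i, measurable_vec (F i)) -> measurable_vec (fun t => \sum_(i <- r) F i t).
Proof.
move=> mF; elim: r => [|j r IH].
  by under eq_fun do rewrite big_nil; exact: measurable_vec_cst.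
by under eq_fun do rewrite big_cons; exact: measurable_vecD.
Qed.

Lemma measurable_enorm X : measurable_vec X ->
  measurable_fun setT (fun t => enorm (X t)).
Proof.
move=> mX.
have ms := continuous_measurable_fun (@sqrt_continuous R).
have mS : measurable_fun setT (fun t => \sum_(i < n) X t ord0 i ^+ 2).
  by apply: measurable_sum => i; exact: measurable_funX.
exact: (measurableT_comp ms mS).
Qed.

End MeasurableVectors.

Section HasMean.
Set Implicit Arguments. Unset Strict Implicit.
Context {R : realType} {d : measure_display} {T : measurableType d}.
Context (mu : probability T R).
Implicit Types (g : T -> R) (m a : R).

(** Pairing integrability with a real value keeps the calculus of means inside [R]. *)
Definition has_mean g m := mu.-integrable setT (fun x => (g x)%:E) /\
  (\int[mu]_x (g x)%:E = m%:E)%E.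

Lemma has_mean_cst a : has_mean (fun=> a) a.
Proof.
split; first exact: finite_measure_integrable_cst.
by rewrite -[RHS]mule1 -(probability_setT mu); exact: integral_cst.
Qed.

Lemma has_meanD g1 g2 m1 m2 : has_mean g1 m1 -> has_mean g2 m2 ->
  has_mean (fun x => g1 x + g2 x) (m1 + m2).
Proof.
move=> [i1 e1] [i2 e2]; split; first exact: (integrableD measurableT i1 i2).
by under eq_integral do rewrite EFinD; rewrite integralD // e1 e2.
Qed.

Lemma has_meanZ a g m : has_mean g m -> has_mean (fun x => a * g x) (a * m).
Proof.
move=> [i e]; split; first exact: (integrableZl measurableT a i).
by under eq_integral do rewrite EFinM; rewrite integralZl // e.
Qed.

Lemma has_meanB g1 g2 m1 m2 : has_mean g1 m1 -> has_mean g2 m2 ->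
  has_mean (fun x => g1 x - g2 x) (m1 - m2).
Proof.
move=> h1 h2; have := has_meanD h1 (has_meanZ (-1) h2).
by rewrite mulN1r; under eq_fun do rewrite mulN1r.
Qed.

Lemma has_mean_sum (I : Type) (r : seq I) (c m : I -> R) (g : I -> T -> R) :
  (forall i, has_mean (g i) (m i)) ->
  has_mean (fun x => \sum_(i <- r) c i * g i x) (\sum_(i <- r) c i * m i).
Proof.
move=> gm; elim: r => [|j r IH].
  by rewrite big_nil; under eq_fun do rewrite big_nil; exact: has_mean_cst.
rewrite big_cons; under eq_fun do rewrite big_cons.
by apply: has_meanD => //; exact: has_meanZ.
Qed.

(** For a nonnegative function, a finite bound on the extended integral already gives integrability;
    the variance bound and the error recursion enter through it. *)
Lemma has_mean_ge0 g m : measurable_fun setT g -> (forall x, 0 <= g x) ->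
  (\int[mu]_x (g x)%:E <= m%:E)%E -> exists2 m', m' <= m & has_mean g m'.
Proof.
move=> mg g0 gm.
have ig0 : (0 <= \int[mu]_x (g x)%:E)%E.
  by apply: integral_ge0 => x _; rewrite lee_fin.
have ifin : (\int[mu]_x (g x)%:E)%E \is a fin_num.
  by rewrite ge0_fin_numE // (le_lt_trans gm) // ltry.
exists (fine (\int[mu]_x (g x)%:E)%E).
  by rewrite -lee_fin fineK.
split; last by rewrite fineK.
apply/integrableP; split; first exact/measurable_EFinP.
under eq_integral => x _ do rewrite gee0_abs ?lee_fin //.
by rewrite (le_lt_trans gm) // ltry.
Qed.

Lemma has_mean_measurable g m : has_mean g m -> measurable_fun setT g.
Proof. by move=> [/integrableP[/measurable_EFinP]]. Qed.

End HasMean.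

(** * Noise of the gradient estimator *)

Section NoiseIntegral.
Set Implicit Arguments. Unset Strict Implicit.
Context {R : realType} {n : nat} {d : measure_display} {Xi : measurableType d}.
Context {f : 'rV[R]_n -> R} {G : 'rV[R]_n -> Xi -> 'rV[R]_n}.
Context {mu : probability Xi R} {flow L1 sigma : R}.
Hypothesis HA : AssumptionA f G mu flow L1 sigma.

Let noise (x : 'rV[R]_n) (y : Xi) : 'rV[R]_n := G x y - grad f x.

Lemma noise_mean x i : has_mean mu (fun y => noise x y ord0 i) 0.
Proof.
case: HA => _ [_ [_ [_ [/(_ x i)[Gi Ge] _]]]].
have -> : (fun y => noise x y ord0 i) = (fun y => G x y ord0 i - grad f x ord0 i).
  by apply/funext => y; rewrite /noise !mxE.
rewrite -(subrr (grad f x ord0 i)).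
by apply: has_meanB => //; exact: has_mean_cst.
Qed.

Lemma noise_dot_mean x a : has_mean mu (fun y => dot a (noise x y)) 0.
Proof.
have := has_mean_sum (index_enum 'I_n) (fun i => a ord0 i) (noise_mean x).
by rewrite big1 // => i _; rewrite mulr0.
Qed.

Lemma measurable_vec_noise x : measurable_vec (noise x).
Proof. by move=> i; exact: has_mean_measurable (noise_mean x i). Qed.

Lemma noise_var x :
  exists2 s, s <= sigma ^+ 2 & has_mean mu (fun y => enorm (noise x y) ^+ 2) s.
Proof.
apply: has_mean_ge0; last by case: HA => _ [_ [_ [_ [_ ]]]]; apply.
  by apply: measurable_funX; apply: measurable_enorm; exact: measurable_vec_noise.
by move=> y; exact: sqr_ge0.
Qed.

(** The vector [a] stands for the drift once the past is frozen. Expanding the square, the cross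
    term has mean zero by unbiasedness, and [sqr_enorm_comb] bounds the quadratic term. *)
Lemma noise_integral (I : Type) (r : seq I) (c : I -> R) (z : I -> 'rV[R]_n)
    (a : 'rV[R]_n) :
  (\int[mu]_y (enorm (a + \sum_(t <- r) c t *: (G (z t) y - grad f (z t))) ^+ 2)%:E
  <= (enorm a ^+ 2 + (\sum_(t <- r) `|c t|) ^+ 2 * sigma ^+ 2)%:E)%E.
Proof.
pose A := \sum_(t <- r) `|c t|.
have A0 : 0 <= A by apply: sumr_ge0.
have [s sle sm] : exists2 s : I -> R, (forall t, s t <= sigma ^+ 2) &
    forall t, has_mean mu (fun y => enorm (noise (z t) y) ^+ 2) (s t).
  have /choice[s hs] : forall t, exists s, s <= sigma ^+ 2 /\
      has_mean mu (fun y => enorm (noise (z t) y) ^+ 2) s.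
    by move=> t; have [s] := noise_var (z t); exists s.
  by exists s => t; case: (hs t).
(* A majorant of the squared norm, linear in quantities whose means are known. *)
pose h y := enorm a ^+ 2 + (2 * (\sum_(t <- r) c t * dot a (noise (z t) y)) +
   A * \sum_(t <- r) `|c t| * enorm (noise (z t) y) ^+ 2).
have [ih eh] : has_mean mu h (enorm a ^+ 2 +
   (2 * (\sum_(t <- r) c t * 0) + A * \sum_(t <- r) `|c t| * s t)).
  apply: has_meanD; first exact: has_mean_cst.
  apply: has_meanD; apply: has_meanZ; apply: has_mean_sum => // t.
  exact: noise_dot_mean.
apply: (@le_trans _ _ (\int[mu]_y (h y)%:E)%E).
  apply: ge0_le_integral => //.
  - by move=> y _; rewrite lee_fin sqr_ge0.
  - apply/measurable_EFinP; apply: measurable_funX; apply: measurable_enorm.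
    apply: measurable_vecD; first exact: measurable_vec_cst.
    apply: measurable_vec_sum => t; apply: measurable_vecZ => //.
    exact: measurable_vec_noise.
  - exact: measurable_int ih.
  - move=> y _; rewrite lee_fin enorm_sq dotDl !dotDr -!enorm_sq.
    rewrite (dotC _ a) /h -addrA lerD2l addrA lerD //.
      rewrite (dotC a) dot_suml mulr_sumr -big_split /=.
      rewrite le_eqVlt; apply/orP; left; apply/eqP.
      by apply: eq_bigr => t _; rewrite dotZl (dotC _ a) -/(noise _ _); ring.
    exact: sqr_enorm_comb.
rewrite eh lee_fin lerD2l big1 ?mulr0 ?add0r => [|t _]; last by rewrite mulr0.
rewrite expr2 -mulrA ler_wpM2l // mulr_suml; apply: ler_sum => t _.
by rewrite ler_wpM2l.
Qed.

Hypothesis HG : G_measurable G.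

(** By unbiasedness [grad f (X t)] is the integral of [G (X t) y] over [y]. Tonelli's theorem for
    the positive and negative parts makes it measurable in [t]. *)
Lemma measurable_vec_grad (dT : measure_display) (T : measurableType dT)
    (X : T -> 'rV[R]_n) :
  measurable_vec X -> measurable_vec (fun t => grad f (X t)).
Proof.
move=> mX i.
pose F (z : T * Xi) : \bar R := (G (X z.1) z.2 ord0 i)%:E.
have mF : measurable_fun setT F.
  apply/measurable_EFinP.
  have mX1 j : measurable_fun setT (fun z : T * Xi => X z.1 ord0 j).
    exact: (measurableT_comp (mX j) measurable_fst).
  exact: (@HG _ _ _ _ mX1 measurable_snd i).
apply/measurable_EFinP.
rewrite (_ : _ \o _ = fun t => (fubini_F mu (F^\+)%E t - fubini_F mu (F^\-)%E t)%E).
  apply: emeasurable_funB.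
    apply: measurable_fun_fubini_tonelli_F => //; exact: measurable_funepos.
  apply: measurable_fun_fubini_tonelli_F => //; exact: measurable_funeneg.
apply/funext => t /=.
case: HA => _ [_ [_ [_ [/(_ (X t) i)[_ <-] _]]]].
rewrite integralE /fubini_F.
by congr (_ - _)%E; apply: eq_integral => y _; rewrite ?funeposE ?funenegE.
Qed.

End NoiseIntegral.

(** * Conditioning on past samples *)

Section Independence.
Set Implicit Arguments. Unset Strict Implicit.
Context {R : realType}.

(** The factorization on rectangles identifies the law of [(X, Y)] as a product measure; Tonelli's
    theorem does the rest. *)
Lemma integral_indep (d d1 d2 : measure_display) (T : measurableType d)
    (T1 : measurableType d1) (T2 : measurableType d2)
    (P : probability T R) (nu : probability T2 R)
    (X : T -> T1) (Y : T -> T2) (F : T1 * T2 -> \bar R) :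
  measurable_fun setT X -> measurable_fun setT Y ->
  (forall A B, measurable A -> measurable B ->
     P (X @^-1` A `&` Y @^-1` B) = (P (X @^-1` A) * nu B)%E) ->
  measurable_fun setT F -> (forall z, 0 <= F z)%E ->
  (\int[P]_w F (X w, Y w) = \int[P]_w \int[nu]_y F (X w, y))%E.
Proof.
move=> mX mY ind mF F0.
pose X' : {mfun T >-> T1} := HB.pack X (isMeasurableFun.Build _ _ _ _ X mX).
have mXY : measurable_fun setT (fun w => (X w, Y w)).
  exact: measurable_fun_pair.
pose XY : {mfun T >-> (T1 * T2)%type} :=
  HB.pack (fun w => (X w, Y w)) (isMeasurableFun.Build _ _ _ _ _ mXY).
rewrite -[LHS](ge0_integral_distribution XY mF F0).
rewrite -[RHS](ge0_integral_distribution X'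
  (measurable_fun_fubini_tonelli_F F mF F0)); last first.
  by move=> x; apply: integral_ge0.
rewrite -(fubini_tonelli1 F mF F0); apply: eq_measure_integral => A mA _.
by apply/esym/product_measure_unique.
Qed.

Section PiSystem.
Context {d : measure_display} {T : measurableType d} (P : probability T R).
Context {C : set (set T)}.
Hypotheses (CI : setI_closed C) (CT : C setT) (Cm : C `<=` measurable).

Lemma measurable_sub_sigma : measurable_fun setT (id : T -> g_sigma_algebraType C).
Proof.
move=> _ A mA; rewrite setTI preimage_id.
have : <<s C >> `<=` @measurable _ T.
  by apply: smallest_sub => //; exact: sigma_algebra_measurable.
exact.
Qed.

(** [P] restricted to [E] and [P] scaled by [P E] are finite measures that agree on the pi-system
    [C]. Both are pushed forward along the identity, to live on the sigma-algebra generated by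
    [C]. *)
Lemma indep_pi_system (E : set T) : measurable E ->
  (forall A, C A -> P (A `&` E) = (P A * P E)%E) ->
  forall A : set (g_sigma_algebraType C), measurable A ->
    P (A `&` E) = (P A * P E)%E.
Proof.
move=> mE indE A mA.
(* The instance is named because unification cannot guess its measurability proof. *)
pose m1 := measure_function_pushforward__canonical__measure_function_Measure
  (mrestr P mE) measurable_sub_sigma.
have PEfin : P E \is a fin_num by exact: fin_num_measure.
have PE0 : 0 <= fine (P E) by rewrite fine_ge0.
pose m2 := mscale (NngNum PE0)
  (measure_function_pushforward__canonical__measure_function_Measure
    P measurable_sub_sigma).
have := @measure_unique _ R (g_sigma_algebraType C) C (fun=> setT) erefl CI
  (fun=> CT) _ m1 m2 _ _ A mA.
rewrite /m1 /m2 /= /mscale /pushforward /= /mrestr preimage_id fineK // => ->.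
- by rewrite muleC.
- by rewrite bigcup_const //; exists 0%N.
- by move=> B CB; rewrite !preimage_id indE // muleC.
- by move=> k; rewrite setTI ltey_eq PEfin.
Qed.

End PiSystem.

End Independence.

Section Past.
Set Implicit Arguments. Unset Strict Implicit.
Context {R : realType} {d dO : measure_display}.
Context {Xi : measurableType d} {Omega : measurableType dO}.
Context (P : probability Omega R) (mu : probability Xi R).
Context (xi : nat -> Omega -> Xi).
Hypothesis mxi : forall k, measurable_fun setT (xi k).

Definition cylinder (k : nat) : set (set Omega) :=
  [set B | exists2 A : nat -> set Xi, (forall j, measurable (A j)) &
    B = \bigcap_(j in [set j | j \in iota 0 k]) (xi j @^-1` A j)].

(* [Omega] equipped with the sigma-algebra generated by [xi 0], ..., [xi (k - 1)]. *)
Definition past (k : nat) := g_sigma_algebraType (cylinder k).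

Lemma cylinder_setI k : setI_closed (cylinder k).
Proof.
move=> _ _ [A mA ->] [B mB ->]; exists (fun j => A j `&` B j).
  by move=> j; exact: measurableI.
by rewrite -bigcapI; apply: eq_bigcapr => j _; rewrite preimage_setI.
Qed.

Lemma cylinder_setT k : cylinder k setT.
Proof.
exists (fun=> setT) => //.
by apply/esym/seteqP; split => // w _ j _.
Qed.

Lemma cylinder_measurable k : cylinder k `<=` measurable.
Proof.
move=> _ [A mA ->]; apply: fin_bigcap_measurable.
  exact: finite_seq.
by move=> j _; rewrite -[X in measurable X]setTI; exact: mxi.
Qed.

Lemma measurable_past k : measurable_fun setT (id : Omega -> past k).
Proof. by apply: measurable_sub_sigma; exact: cylinder_measurable. Qed.

Lemma past_measurable_fun k d' (T : measurableType d') (g : Omega -> T) :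
  measurable_fun setT (g : past k -> T) -> measurable_fun setT g.
Proof. by move=> mg; exact: (measurableT_comp mg (measurable_past (k := k))). Qed.

Lemma measurable_xi_past k j : (j < k)%N ->
  measurable_fun setT (xi j : past k -> Xi).
Proof.
move=> jk _ A mA; rewrite setTI; apply: sub_sigma_algebra.
exists (fun i => if i == j then A else setT).
  by move=> i; case: ifP.
apply/seteqP; split => [w wA i _ | w /(_ j)] /=.
  by case: eqP => // ->.
by rewrite eqxx; apply; rewrite mem_iota.
Qed.

Hypothesis law : forall k (A : set Xi), measurable A -> P (xi k @^-1` A) = mu A.
Hypothesis indep : forall (s : seq nat) (A : nat -> set Xi), uniq s ->
  (forall k, measurable (A k)) ->
  P (\bigcap_(k in [set j | j \in s]) (xi k @^-1` A k)) =
  (\prod_(k <- s) P (xi k @^-1` A k))%E.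

(** The intersection is again a finite intersection, over the duplicate-free list [k :: iota 0 k];
    the product formula is applied to this list and to its tail. *)
Lemma cylinder_indep_xi k (A : set Omega) (B : set Xi) : cylinder k A ->
  measurable B -> P (A `&` xi k @^-1` B) = (P A * P (xi k @^-1` B))%E.
Proof.
move=> [C mC ->] mB.
pose D j := if j == k then B else C j.
have mD j : measurable (D j) by rewrite /D; case: ifP.
have ki : k \notin iota 0 k by rewrite mem_iota add0n ltnn andbF.
have DC j : j \in iota 0 k -> D j = C j.
  by rewrite /D; case: eqP => // -> /(negP ki).
have -> : \bigcap_(j in [set j | j \in iota 0 k]) (xi j @^-1` C j) `&`
    xi k @^-1` B = \bigcap_(j in [set j | j \in k :: iota 0 k]) (xi j @^-1` D j).
  apply/seteqP; split => [w [wC wB] j /= | w wD].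
    rewrite in_cons => /orP[/eqP ->|ji]; first by rewrite /D eqxx.
    by rewrite DC //; exact: wC.
  split => [j /= ji|].
    by rewrite -DC //; apply: wD; rewrite /= in_cons ji orbT.
  by have := wD k; rewrite /= in_cons eqxx /D eqxx; apply.
rewrite indep //; last by rewrite /= ki iota_uniq.
have Dk : D k = B by rewrite /D eqxx.
rewrite big_cons Dk muleC; congr (_ * _)%E.
rewrite indep ?iota_uniq //; apply: eq_big_seq => j ji.
by rewrite DC.
Qed.

(** The freezing lemma that stands in for conditional expectation: the next sample may be averaged
    out first, with the past held fixed. *)
Lemma integral_past_xi k (F : past k * Xi -> \bar R) :
  measurable_fun setT F -> (forall z, 0 <= F z)%E ->
  (\int[P]_w F (w, xi k w) = \int[P]_w \int[mu]_y F (w, y))%E.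
Proof.
move=> mF F0.
apply: (@integral_indep _ _ _ _ Omega (past k) Xi P mu (id : Omega -> past k)
  (xi k) F) => //; first exact: measurable_past.
move=> A B mA mB; rewrite preimage_id -(law k) //.
apply: (indep_pi_system (@cylinder_setI k) (cylinder_setT k)
  (@cylinder_measurable k)) => //.
  by rewrite -[X in measurable X]setTI; exact: mxi.
by move=> C CC; exact: cylinder_indep_xi.
Qed.

(** Meant for the events that fix the value of the random index. On the sigma-algebra of the past,
    [P] restricted to [E] is [P E] times [P]. *)
Lemma integral_past_event k (E : set Omega) (g : Omega -> R) : measurable E ->
  (forall A, cylinder k A -> P (A `&` E) = (P A * P E)%E) ->
  measurable_fun setT (g : past k -> R) -> (forall w, 0 <= g w) ->
  (\int[P]_(w in E) (g w)%:E = P E * \int[P]_w (g w)%:E)%E.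
Proof.
move=> mE indE mg g0.
have mgE : measurable_fun setT (EFin \o g : past k -> \bar R) by exact/measurable_EFinP.
have mgO : measurable_fun setT (EFin \o g) by exact: past_measurable_fun mgE.
have g0E w : (0 <= (EFin \o g) w)%E by rewrite lee_fin.
(* The restricted measure vanishes on the complement of [E]. *)
have restrE : (\int[mrestr P mE]_w (g w)%:E = \int[P]_(w in E) (g w)%:E)%E.
  rewrite -(setUv E) ge0_integral_setU //; first last.
  - by apply/disj_setPS; rewrite setICr.
  - by move=> w _; exact: g0E.
  - by rewrite setUv.
  - exact: measurableC.
  rewrite [X in (_ + X)%E](_ : _ = 0%E) ?adde0.
    apply: eq_measure_integral => A mA AE.
    by rewrite -{2}(setIidl AE).
  rewrite (eq_measure_integral mzero) ?integral_measure_zero // => A mA AE.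
  transitivity (P (A `&` E)) => //.
  rewrite (_ : A `&` E = set0) ?measure0 //.
  by apply/seteqP; split => // w [/AE].
pose m2 := measure_function_pushforward__canonical__measure_function_Measure
  P (measurable_past (k := k)).
have PEfin : P E \is a fin_num by exact: fin_num_measure.
have PE0 : 0 <= fine (P E) by rewrite fine_ge0.
have pushE (Q : {measure set Omega -> \bar R}) :
    (\int[measure_function_pushforward__canonical__measure_function_Measure
       Q (measurable_past (k := k))]_w (g w)%:E = \int[Q]_w (g w)%:E)%E.
  apply: (ge0_integral_pushforward (measurable_past (k := k)) Q measurableT mgE).
  by move=> w _; exact: g0E.
rewrite -restrE -(pushE (mrestr P mE)).
transitivity (\int[mscale (NngNum PE0) m2]_w (g w)%:E)%E.
  apply: eq_measure_integral => A mA _.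
  rewrite /m2 /= /mscale /pushforward /= /mrestr preimage_id fineK // muleC.
  exact: (indep_pi_system (@cylinder_setI k) (cylinder_setT k)
    (@cylinder_measurable k) mE indE).
rewrite (ge0_integral_mscale m2 measurableT (NngNum PE0) mgE) //.
by congr (_ * _)%E; [exact: fineK | exact: pushE].
Qed.

End Past.

(** * The algorithm *)

Section FinalRate.
Set Implicit Arguments. Unset Strict Implicit.
Context {R : realType}.

(** Here [k + p <= 2K], and the exponent is at most 1, so the 2 contributes at most 2. *)
Lemma eta_p_ge p k K : (1 < p)%N -> (2 * p <= K)%N -> (k < K)%N ->
  (2 * (K%:R `^ ((3 * p + 1)%:R^-1)) ^+ (2 * p + 1))^-1 <= eta_p p k :> R.
Proof.
move=> p1 pK kK; rewrite /eta_p -powR_frac ?ler0n //.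
have K0 : (0 < K)%N by lia.
have a0 : 0 < (k + p)%:R :> R by rewrite ltr0n; lia.
have Kr : 0 < K%:R :> R by rewrite ltr0n.
rewrite lef_pV2 ?posrE ?mulr_gt0 ?powR_gt0 //.
set r : R := _ / _.
have r01 : 0 <= r <= 1.
  rewrite divr_ge0 //= ler_pdivrMr ?ltr0n ?addn1 // mul1r ler_nat; lia.
case/andP: r01 => r0 r1.
apply: (@le_trans _ _ ((2 * K%:R) `^ r)).
  apply: ge0_ler_powR; rewrite ?nnegrE ?mulr_ge0 // -natrM ler_nat; lia.
rewrite powRM // ler_wpM2r ?powR_ge0 //.
by apply: ler1_powR => //; rewrite ler1n.
Qed.

(** Since [ln K >= 1], the constant [A] is absorbed into [A ln K], and the weighted sum is at most
    [(A + 2B) ln K <= M ln K / 4]. *)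
Lemma average_le p K (g : nat -> R) (A B M eps : R) : (1 < p)%N -> (2 * p <= K)%N ->
  (forall k, 0 <= g k) -> 0 <= A -> 0 <= B -> 0 < M -> 4 * (A + 2 * B) <= M ->
  0 < eps ->
  \sum_(k < K) eta_p p k * g k <= A + B * \sum_(k < K) ((k + p)%:R)^-1 ->
  let c := (6 * p + 2)%:R * M / (p%:R * eps) in
  (c * ln c) `^ ((3 * p + 1)%:R / p%:R) <= K%:R ->
  K%:R^-1 * \sum_(k < K) g k <= eps.
Proof.
move=> p1 pK.
have K4 : (4 <= K)%N by lia.
have K0 : (0 < K)%N by lia.
have E6 : (6 * p + 2 = 2 * (3 * p + 1))%N by lia.
have E3 : (3 * p + 1 = p + (2 * p + 1))%N by lia.
move=> g0 A0 B0 M0 ABM eps0 gsum c cK.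
have p0 : 0 < p%:R :> R by rewrite ltr0n ltnW.
have N0 : 0 < (3 * p + 1)%:R :> R by rewrite ltr0n addn1.
have c0 : 0 < c by rewrite divr_gt0 ?mulr_gt0 // ltr0n E6 muln_gt0 addn1.
have := @complexity R p K c p1 K0 c0 cK.
have L1 : 1 <= ln (K%:R : R) by apply: ln_ge1.
have KE : K%:R = (K%:R `^ ((3 * p + 1)%:R^-1)) ^+ (3 * p + 1) :> R.
  by rewrite -powR_frac ?ler0n // divff ?lt0r_neq0 // powRr1.
have eK k := @eta_p_ge p k K p1 pK.
have hS := @harmonic_le R p K p1 pK.
move: KE eK hS L1 gsum; set b := K%:R `^ _; set L := ln _; set S := \sum_(_ < _) _^-1.
move=> KE eK hS L1 gsum.
have b0 : 0 < b by rewrite powR_gt0 // ltr0n.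
(* The factor [(6p+2)/p] in [c] undoes [p/(3p+1)] up to 2, so [complexity] becomes [M L <= eps b^p],
   where [b^(3p+1) = K]. *)
have -> : c * L * p%:R / (3 * p + 1)%:R = 2 * (M * L / eps).
  rewrite /c E6 natrM; move: N0 p0; move: (3 * p + 1)%:R (p%:R : R) => N q N0 q0.
  by field; rewrite !lt0r_neq0.
rewrite ler_pM2l // ler_pdivrMr // => ML.
have h1 : \sum_(k < K) eta_p p k * g k <= M * L / 4.
  apply: (le_trans gsum).
  have L0 : 0 <= L by apply: le_trans L1.
  have := ler_wpM2l B0 hS; have := ler_wpM2r L0 ABM; have := ler_wpM2l A0 L1.
  clear; lra.
have h2 : (2 * b ^+ (2 * p + 1))^-1 * \sum_(k < K) g k <= M * L / 4.
  apply: le_trans h1; rewrite mulr_sumr; apply: ler_sum => k _.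
  by rewrite ler_wpM2r //; exact: eK.
have bp : 0 < b ^+ p by rewrite exprn_gt0.
have bq : 0 < b ^+ (2 * p + 1) by rewrite exprn_gt0.
rewrite ler_pdivrMl ?mulr_gt0 // in h2.
rewrite KE E3 exprD ler_pdivrMl ?mulr_gt0 //.
apply: (le_trans h2).
have := ler_wpM2l (ltW bq) ML; have := mulr_gt0 eps0 (mulr_gt0 bp bq).
by clear; lra.
Qed.

End FinalRate.

Section Algorithm.
Set Implicit Arguments. Unset Strict Implicit.
Context {R : realType} {n : nat} {Xi : Type}.
Context (G : 'rV[R]_n -> Xi -> 'rV[R]_n) (x0 : 'rV[R]_n) (p : nat).
Hypothesis p1 : (1 < p)%N.

Definition sfom_xp (s : nat -> Xi) k :=
  sfom_x G x0 (eta_p p) p.-1 (gam_p p) (theta_p p) s k.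
Definition sfom_mp (s : nat -> Xi) k :=
  sfom_m G x0 (eta_p p) p.-1 (gam_p p) (theta_p p) s k.
Definition sfom_dir (s : nat -> Xi) k := - ((enorm (sfom_mp s k))^-1 *: sfom_mp s k).
(* [sfom_z s k t] is the point [z^{k+1,t} = x^k + (x^{k+1} - x^k) / gamma_{k,t}]. *)
Definition sfom_z (s : nat -> Xi) k t :=
  sfom_xp s k + (t%:R * pw_p p k * eta_p p k) *: sfom_dir s k.
Definition momentum_decay k : R := \prod_(1 <= t < p) (1 - (t%:R * pw_p p k)^-1).

Lemma sfom_xpS s k :
  sfom_xp s k.+1 = sfom_xp s k - (eta_p p k / enorm (sfom_mp s k)) *: sfom_mp s k.
Proof.
rewrite /sfom_xp /sfom_mp /sfom_x /sfom_m /=.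
by case: (sfom_state _ _ _ _ _ _ _ _) => -[? ?] ? /=.
Qed.

Lemma sfom_xpS_dir s k : sfom_xp s k.+1 = sfom_xp s k + eta_p p k *: sfom_dir s k.
Proof. by rewrite sfom_xpS scalerN scalerA. Qed.

(** The initial conventions put all [p-1] points at [x0] with equal weights [1/(p-1)], so the first
    momentum is a plain stochastic gradient. *)
Lemma sfom_mp0 s : sfom_mp s 0 = G x0 (s 0%N).
Proof.
rewrite /sfom_mp /sfom_m /= scaler0 add0r.
under eq_bigr do rewrite subrr mul0r scale0r addr0.
rewrite sumr_const_nat subn1 /= -scaler_nat scalerA divff ?scale1r //.
by rewrite pnatr_eq0; lia.
Qed.

(** Exactness of the interpolation on the constant polynomial 1. *)
Lemma momentum_decayE k :
  1 - \sum_(1 <= t < p) theta_p p k t = momentum_decay k.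
Proof.
have := @extrapolation_exact R p (pw_p p k) 1 (ltnW p1) (pw_p_gt0 p k p1).
rewrite size_poly1 => /(_ (ltnW p1)); rewrite !hornerC mulr1 => E.
rewrite -[X in X - _]E /momentum_decay.
under [X in _ + X - _]eq_bigr do rewrite hornerC mulr1.
by rewrite addrK.
Qed.

Lemma sfom_mpS s k : sfom_mp s k.+1 = momentum_decay k *: sfom_mp s k +
  \sum_(1 <= t < p) theta_p p k t *: G (sfom_z s k t) (s k.+1).
Proof.
rewrite -momentum_decayE.
have -> : sfom_mp s k.+1 = (1 - \sum_(1 <= t < p.-1.+1) theta_p p k t) *: sfom_mp s k +
   \sum_(1 <= t < p.-1.+1) theta_p p k t *:
     G (sfom_xp s k.+1 + ((1 - gam_p p k t) / gam_p p k t) *: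
        (sfom_xp s k.+1 - sfom_xp s k)) (s k.+1).
  rewrite /sfom_xp /sfom_mp /sfom_x /sfom_m /=.
  by case: (sfom_state _ _ _ _ _ _ _ _) => -[? ?] ? /=.
rewrite prednK ?(ltnW p1) //; congr (_ + _).
apply: eq_big_nat => t /andP[t0 _]; congr (_ *: G _ _).
rewrite sfom_xpS_dir (addrC (sfom_xp s k)) addrK scalerA addrAC -scalerDl addrC.
rewrite /sfom_z; congr (_ + _ *: _).
have w0 : (pw_p p k : R) != 0 by rewrite lt0r_neq0 // pw_p_gt0.
have tr : (t%:R : R) != 0 by rewrite pnatr_eq0 -lt0n.
by rewrite /gam_p; field; rewrite ?tr ?w0.
Qed.

Lemma enorm_sfom_dir s k : sfom_mp s k != 0 -> enorm (sfom_dir s k) = 1.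
Proof. by move=> m0; rewrite enormN enorm_normalize. Qed.

Context (f : 'rV[R]_n -> R).

Definition sfom_err s k := sfom_mp s k - grad f (sfom_xp s k).
Definition sfom_bias s k := momentum_decay k *: grad f (sfom_xp s k) +
  \sum_(1 <= t < p) theta_p p k t *: grad f (sfom_z s k t) - grad f (sfom_xp s k.+1).
(** The part of [sfom_err s k.+1] determined by the samples [s 0, ..., s k]; what remains is the
    noise of the sample [s k.+1]. *)
Definition sfom_drift s k := momentum_decay k *: sfom_err s k + sfom_bias s k.

Lemma sfom_errS s k : sfom_err s k.+1 = sfom_drift s k +
  \sum_(1 <= t < p) theta_p p k t *:
    (G (sfom_z s k t) (s k.+1) - grad f (sfom_z s k t)).
Proof.
under eq_bigr do rewrite scalerBr.
rewrite sumrB /sfom_drift /sfom_err sfom_mpS /sfom_bias scalerBr.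
move: (momentum_decay k *: _) (momentum_decay k *: _) (\sum_(1 <= t < p) _).
move=> a b c; move: (\sum_(1 <= t < p) _) (grad f _) => e g.
rewrite !addrA subrK -!addrA; congr (_ + _).
by rewrite addrCA (addrC e) subrK addrC.
Qed.

(** Convexity of the square: with [v = 1/w], [(1 - v) E + B] averages [E] and [B / v] with weights
    [1 - v] and [v], so its square is at most [(1 - v) E^2 + w B^2]. *)
Lemma sfom_drift_le (Lp : R) s k : AssumptionB p f Lp -> sfom_mp s k != 0 ->
  enorm (sfom_drift s k) ^+ 2 <= (1 - (pw_p p k)^-1) * enorm (sfom_err s k) ^+ 2 +
    4 * p%:R ^+ (2 * p) * Lp ^+ 2 / pw_p p k ^+ 2.
Proof.
move=> HB m0.
have w1 := pw_p_ge1 p k p1 : 1 <= (pw_p p k : R).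
have w0 := pw_p_gt0 p k p1 : 0 < (pw_p p k : R).
have eta0 := eta_p_gt0 p k p1 : 0 < (eta_p p k : R).
have Lp0 : 0 < Lp by case: HB => _ [_ []].
have /andP[c0 c1] := momentum_weight_bounds p _ p1 w1 : 0 <= momentum_decay k <= _.
have p0 := ltnW p1.
pose B := 2 * p%:R ^+ p * Lp * (eta_p p k ^+ p * pw_p p k ^+ p.-1).
have B0 : 0 <= B by rewrite !mulr_ge0 ?exprn_ge0 ?(ltW w0) ?(ltW eta0) ?(ltW Lp0).
have hB : enorm (sfom_bias s k) <= B.
  have := bias_le (sfom_xp s k) HB w1 (ltW eta0) (enorm_sfom_dir m0).
  rewrite -sfom_xpS_dir => /le_trans; apply.
  have e0 : 0 <= Lp / p`!%:R * eta_p p k ^+ p.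
    by rewrite !mulr_ge0 ?exprn_ge0 ?invr_ge0 ?(ltW eta0) ?(ltW Lp0).
  apply: le_trans (ler_wpM2l e0 (sum_extrap_weight_pow_le p _ p0 w1)) _.
  rewrite /B le_eqVlt; apply/orP; left; apply/eqP.
  by field; rewrite pnatr_eq0 -lt0n fact_gt0.
have hB2 : B ^+ 2 * pw_p p k = 4 * p%:R ^+ (2 * p) * Lp ^+ 2 / pw_p p k ^+ 2.
  rewrite -(bias_rate p k p1) /B (mulnC 2%N p) exprM; ring.
have E0 := enorm_ge0 (sfom_err s k).
have hd : enorm (sfom_drift s k) <= (1 - (pw_p p k)^-1) * enorm (sfom_err s k) + B.
  apply: le_trans (enormD _ _) _; apply: lerD => //.
  by rewrite enormZ ger0_norm // ler_wpM2r.
rewrite -hB2.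
have wi : (pw_p p k)^-1 <= 1 :> R by rewrite invf_le1.
have wi0 : 0 < (pw_p p k)^-1 :> R by rewrite invr_gt0.
have hd0 : 0 <= (1 - (pw_p p k)^-1) * enorm (sfom_err s k) + B.
  by rewrite addr_ge0 // mulr_ge0 // subr_ge0.
apply: (@le_trans _ _ (((1 - (pw_p p k)^-1) * enorm (sfom_err s k) + B) ^+ 2)).
  by rewrite lerXn2r // nnegrE enorm_ge0.
have : (pw_p p k : R) * (pw_p p k)^-1 = 1 by rewrite divff // lt0r_neq0.
move: (pw_p p k : R) ((pw_p p k : R)^-1) (enorm (sfom_err s k)) w0 w1 wi wi0 E0.
move=> w v E w0 w1 v1 v0 E0 wv.
have -> : w = v^-1 by apply: (mulIf (lt0r_neq0 v0)); rewrite wv mulVf // lt0r_neq0.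
rewrite -subr_ge0.
have -> : (1 - v) * E ^+ 2 + B ^+ 2 * v^-1 - ((1 - v) * E + B) ^+ 2 =
   (1 - v) * v * (E - B / v) ^+ 2 by field; rewrite lt0r_neq0.
by rewrite mulr_ge0 ?sqr_ge0 // mulr_ge0 ?subr_ge0 // ltW.
Qed.

Lemma sfom_path_sum (flow L1 : R) s K : Cp p f -> 0 <= L1 ->
  (forall x y, enorm (grad f y - grad f x) <= L1 * enorm (y - x)) ->
  (forall x, flow <= f x) -> (forall k, sfom_mp s k != 0) ->
  \sum_(k < K) eta_p p k * enorm (grad f (sfom_xp s k)) <=
  f x0 - flow + (2 + L1 / 2) * \sum_(k < K) ((k + p)%:R)^-1 +
  \sum_(k < K) 2^-1 * (pot_p p k / pw_p p k) * enorm (sfom_err s k) ^+ 2.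
Proof.
move=> Cf L10 fL fl m0.
suff : \sum_(k < K) eta_p p k * enorm (grad f (sfom_xp s k)) <=
    f x0 - f (sfom_xp s K) + (2 + L1 / 2) * \sum_(k < K) ((k + p)%:R)^-1 +
    \sum_(k < K) 2^-1 * (pot_p p k / pw_p p k) * enorm (sfom_err s k) ^+ 2.
  by move=> /le_trans; apply; rewrite !lerD2r lerD2l lerN2.
elim: K => [|K IH]; first by rewrite !big_ord0 subrr mulr0 !addr0.
rewrite !big_ord_recr /=.
have := @normalized_step R n p f L1 (eta_p p K) (sfom_xp s K) (sfom_mp s K)
  p1 Cf fL (ltW (eta_p_gt0 p K p1)) (m0 K).
rewrite -sfom_xpS -/(sfom_err s K).
have := @eta_sqr_pw_p R p K p1; have := @eta_sqr_le R p K p1.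
have := @pw_p_gt0 R p K p1; have := @pot_p_gt0 R p K p1; have := @eta_p_gt0 R p K p1.
have := enorm_ge0 (sfom_err s K).
move: (enorm (sfom_err s K)) (eta_p p K : R) (pot_p p K : R) (pw_p p K : R) => e eta q w.
move=> e0 eta0 q0 w0 h1 h2 h3.
(* The second term has exactly the weight that [potential_sum] controls; the first is [2/(K+p)]. *)
have young : 2 * eta * e <= 2 * (eta ^+ 2 * w / q) + 2^-1 * (q / w) * e ^+ 2.
  have v0 : 0 < w / q by rewrite divr_gt0.
  have -> : q / w = (w / q)^-1 by rewrite invf_div.
  rewrite -[eta ^+ 2 * w / q]mulrA; move: (w / q) v0 => v v0.
  rewrite -subr_ge0.
  have -> : 2 * (eta ^+ 2 * v) + 2^-1 * v^-1 * e ^+ 2 - 2 * eta * e =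
     2^-1 * v^-1 * (2 * eta * v - e) ^+ 2 by field; rewrite lt0r_neq0.
  by rewrite mulr_ge0 ?sqr_ge0 // divr_ge0 ?invr_ge0 // ltW.
have := ler_wpM2l L10 h1.
rewrite h2 in young; lra.
Qed.

End Algorithm.

Section MeasurableIterates.
Set Implicit Arguments. Unset Strict Implicit.
Context {R : realType} {n : nat} {d : measure_display} {Xi : measurableType d}.
Context {G : 'rV[R]_n -> Xi -> 'rV[R]_n} (x0 : 'rV[R]_n).
Context (eta : nat -> R) (q : nat) (gam theta : nat -> nat -> R).
Hypothesis HG : G_measurable G.

Lemma measurable_enormV (dT : measure_display) (T : measurableType dT)
    (X : T -> 'rV[R]_n) : measurable_vec X ->
  measurable_fun setT (fun t => (enorm (X t))^-1).
Proof.
move=> mX; rewrite (_ : (fun t => _) = (fun t => enorm (X t) `^ (-1))).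
  exact: (measurableT_comp (measurable_powR _) (measurable_enorm mX)).
by apply/funext => t; rewrite powR_inv1 // enorm_ge0.
Qed.

(** [T] is arbitrary so that the lemma applies to [past xi j], where measurability expresses
    dependence on the first [j] samples only. *)
Lemma measurable_sfom_state (dT : measure_display) (T : measurableType dT)
    (y : nat -> T -> Xi) (k : nat) :
  (forall j, (j < k)%N -> measurable_fun setT (y j)) ->
  let st t := sfom_state G x0 eta q gam theta (fun j => y j t) k in
  [/\ measurable_vec (fun t => (st t).1.1), measurable_vec (fun t => (st t).1.2) &
      measurable_vec (fun t => (st t).2)].
Proof.
elim: k => [_ st|k IH my st].
  by split; exact: measurable_vec_cst.
pose st' t := sfom_state G x0 eta q gam theta (fun j => y j t) k.
have [m1 m2 m3] : [/\ measurable_vec (fun t => (st' t).1.1),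
    measurable_vec (fun t => (st' t).1.2) & measurable_vec (fun t => (st' t).2)].
  by apply: IH => j jk; apply: my; exact: ltnW.
pose z s t := (st' t).1.1 + ((1 - gam_prev gam k s) / gam_prev gam k s) *:
  ((st' t).1.1 - (st' t).1.2).
pose mk t := (1 - \sum_(1 <= s < q.+1) theta_prev q theta k s) *: (st' t).2 +
  \sum_(1 <= s < q.+1) theta_prev q theta k s *: G (z s t) (y k t).
have stE t : st t = ((st' t).1.1 - (eta k / enorm (mk t)) *: mk t, (st' t).1.1, mk t).
  rewrite /st /mk /z /st' /=; by case: (sfom_state _ _ _ _ _ _ _ k) => -[].
have mz s : measurable_vec (z s).
  apply: measurable_vecD => //; apply: measurable_vecZ => //.
  exact: measurable_vecB.
have mG s : measurable_vec (fun t => G (z s t) (y k t)).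
  by move=> i; apply: (@HG _ _ _ _ (mz s) _ i); exact: my.
have mmk : measurable_vec mk.
  apply: measurable_vecD; first exact: measurable_vecZ.
  by apply: measurable_vec_sum => s; exact: measurable_vecZ.
split.
- under eq_fun do rewrite stE /=.
  apply: measurable_vecB => //; apply: measurable_vecZ => //.
  by apply: measurable_funM => //; exact: measurable_enormV.
- by under eq_fun do rewrite stE /=.
- by under eq_fun do rewrite stE /=.
Qed.

End MeasurableIterates.

(** * Mean errors, mean gradient norms and the random index *)

Section Convergence.
Set Implicit Arguments. Unset Strict Implicit.
Context {R : realType} {n : nat} {d dO : measure_display}.
Context {Xi : measurableType d} {Omega : measurableType dO}.
Context {mu : probability Xi R} {P : probability Omega R}.
Context {f : 'rV[R]_n -> R} {G : 'rV[R]_n -> Xi -> 'rV[R]_n}.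
Context {flow L1 sigma Lp : R} {p : nat} (x0 : 'rV[R]_n).
Context {xi : nat -> Omega -> Xi}.
Hypotheses (HA : AssumptionA f G mu flow L1 sigma) (HB : AssumptionB p f Lp).
Hypothesis HG : G_measurable G.
Hypothesis mxi : forall k, measurable_fun setT (xi k).
Hypothesis law : forall k (A : set Xi), measurable A -> P (xi k @^-1` A) = mu A.
Hypothesis indep : forall (s : seq nat) (A : nat -> set Xi), uniq s ->
  (forall k, measurable (A k)) ->
  P (\bigcap_(k in [set j | j \in s]) (xi k @^-1` A k)) =
  (\prod_(k <- s) P (xi k @^-1` A k))%E.

Let path (w : Omega) : nat -> Xi := fun j => xi j w.
Let X k w := sfom_xp G x0 p (path w) k.
Let M k w := sfom_mp G x0 p (path w) k.
Let Z k t w := sfom_z G x0 p (path w) k t.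
Let err k w := sfom_err G x0 p f (path w) k.
Let drift k w := sfom_drift G x0 p f (path w) k.

Hypothesis m0 : forall k w, M k w != 0.

Let p1 : (1 < p)%N. Proof. by case: HB. Qed.

(** [x^k] uses the samples before [k], hence [k <= j]; [m^k] also uses sample [k], hence the strict
    inequality in [measurable_past_m]. *)
Lemma measurable_past_x k j : (k <= j)%N ->
  measurable_vec (X k : past xi j -> 'rV[R]_n).
Proof.
move=> kj.
have my i : (i < k)%N -> measurable_fun setT (xi i : past xi j -> Xi).
  by move=> ik; apply: measurable_xi_past; exact: leq_trans kj.
by have [] := measurable_sfom_state x0 (eta_p p) p.-1 (gam_p p) (theta_p p) HG my.
Qed.

Lemma measurable_past_m k j : (k < j)%N ->
  measurable_vec (M k : past xi j -> 'rV[R]_n).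
Proof.
move=> kj.
have my i : (i < k.+1)%N -> measurable_fun setT (xi i : past xi j -> Xi).
  by move=> ik; apply: measurable_xi_past; exact: leq_trans kj.
by have [] := measurable_sfom_state x0 (eta_p p) p.-1 (gam_p p) (theta_p p) HG my.
Qed.

Lemma measurable_past_grad k j : (k <= j)%N ->
  measurable_vec (fun w : past xi j => grad f (X k w)).
Proof. by move=> kj; apply: (measurable_vec_grad HA HG); exact: measurable_past_x. Qed.

Lemma measurable_past_err k j : (k < j)%N ->
  measurable_vec (err k : past xi j -> 'rV[R]_n).
Proof.
move=> kj; apply: measurable_vecB; first exact: measurable_past_m.
by apply: measurable_past_grad; exact: ltnW.
Qed.

Lemma measurable_past_z k t j : (k < j)%N ->
  measurable_vec (Z k t : past xi j -> 'rV[R]_n).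
Proof.
move=> kj; apply: measurable_vecD; first by apply: measurable_past_x; exact: ltnW.
apply: measurable_vecZ => //.
have mm := measurable_past_m kj.
rewrite (_ : (fun w => _) = (fun w : past xi j => 0 - (enorm (M k w))^-1 *: M k w)).
  apply: measurable_vecB; first exact: measurable_vec_cst.
  by apply: measurable_vecZ => //; exact: measurable_enormV.
by apply/funext => w; rewrite sub0r.
Qed.

Lemma measurable_past_drift k j : (k < j)%N ->
  measurable_vec (drift k : past xi j -> 'rV[R]_n).
Proof.
move=> kj; apply: measurable_vecD.
  by apply: measurable_vecZ => //; exact: measurable_past_err.
apply: measurable_vecB; last exact: measurable_past_grad.
apply: measurable_vecD.
  by apply: measurable_vecZ => //; apply: measurable_past_grad; exact: ltnW.
apply: measurable_vec_sum => t; apply: measurable_vecZ => //.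
by apply: (measurable_vec_grad HA HG); exact: measurable_past_z.
Qed.

Lemma measurable_err k : measurable_fun setT (fun w => enorm (err k w) ^+ 2).
Proof.
apply: measurable_funX; apply: (past_measurable_fun mxi (k := k.+1)).
by apply: measurable_enorm; exact: measurable_past_err.
Qed.

Lemma measurable_enorm_grad k :
  measurable_fun setT (fun w : past xi k => enorm (grad f (X k w))).
Proof. by apply: measurable_enorm; exact: measurable_past_grad. Qed.

Let sq (v : 'rV[R]_n) : \bar R := (enorm v ^+ 2)%:E.

Lemma measurable_sq (dT : measure_display) (T : measurableType dT)
  (V : T -> 'rV[R]_n) : measurable_vec V -> measurable_fun setT (fun t => sq (V t)).
Proof.
move=> mV; apply/measurable_EFinP; apply: measurable_funX.
exact: measurable_enorm.
Qed.

Lemma measurable_pair_vec (dT : measure_display) (T : measurableType dT)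
    (V : T -> 'rV[R]_n) : measurable_vec V ->
  measurable_vec (fun z : T * Xi => V z.1).
Proof. by move=> mV i; exact: (measurableT_comp (mV i) measurable_fst). Qed.

Lemma measurable_pair_noise (dT : measure_display) (T : measurableType dT)
    (V : T -> 'rV[R]_n) : measurable_vec V ->
  measurable_vec (fun z : T * Xi => G (V z.1) z.2 - grad f (V z.1)).
Proof.
move=> mV; apply: measurable_vecB.
  by move=> i; exact: (@HG _ _ _ _ (measurable_pair_vec mV) measurable_snd i).
exact: (measurable_pair_vec (V := fun t => grad f (V t)) (measurable_vec_grad HA HG mV)).
Qed.

Lemma err_mean0 : exists2 m, m <= sigma ^+ 2 &
  has_mean P (fun w => enorm (err 0%N w) ^+ 2) m.
Proof.
apply: has_mean_ge0; first exact: measurable_err.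
  by move=> w; exact: sqr_ge0.
(* The freezing lemma is used with the trivial past [past xi 0]. *)
pose F (z : past xi 0 * Xi) := sq (G x0 z.2 - grad f x0).
have mF : measurable_fun setT F.
  apply: measurable_sq.
  exact: (measurable_pair_noise (measurable_vec_cst (T := past xi 0) x0)).
have F0 z : (0 <= F z)%E by rewrite lee_fin sqr_ge0.
rewrite (_ : (\int[P]_w _)%E = (\int[P]_w F (w, xi 0%N w))%E); last first.
  by apply: eq_integral => w _; rewrite /F /err /sfom_err sfom_mp0.
rewrite (integral_past_xi mxi law indep mF F0).
have [_ <-] := has_mean_cst P (sigma ^+ 2).
apply: ge0_le_integral => //.
- by move=> w _; apply: integral_ge0 => y _; exact: F0.
- exact: (past_measurable_fun mxi (measurable_fun_fubini_tonelli_F F mF F0)).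
- by move=> w _; case: HA => _ [_ [_ [_ [_ ]]]]; apply.
Qed.

Let D := 4 * p%:R ^+ (2 * p) * Lp ^+ 2 + p`!%:R ^+ 2 * sigma ^+ 2.

(** The sample [xi k.+1] is integrated out first, with the drift and the points [Z k t] frozen; then
    the pathwise bound on the drift is averaged. *)
Lemma err_meanS k m : has_mean P (fun w => enorm (err k w) ^+ 2) m ->
  exists2 m', m' <= (1 - (pw_p p k)^-1) * m + D / pw_p p k ^+ 2 &
    has_mean P (fun w => enorm (err k.+1 w) ^+ 2) m'.
Proof.
move=> hm; apply: has_mean_ge0; first exact: measurable_err.
  by move=> w; exact: sqr_ge0.
pose F (z : past xi k.+1 * Xi) := sq (drift k z.1 +
   \sum_(1 <= t < p) theta_p p k t *: (G (Z k t z.1) z.2 - grad f (Z k t z.1))).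
have mF : measurable_fun setT F.
  apply: measurable_sq; apply: measurable_vecD.
    exact: (measurable_pair_vec (measurable_past_drift (ltnSn k))).
  apply: measurable_vec_sum => t; apply: measurable_vecZ => //.
  exact: (measurable_pair_noise (measurable_past_z t (ltnSn k))).
have F0 z : (0 <= F z)%E by rewrite lee_fin sqr_ge0.
rewrite (_ : (\int[P]_w _)%E = (\int[P]_w F (w, xi k.+1 w))%E); last first.
  by apply: eq_integral => w _; rewrite /F /err sfom_errS.
rewrite (integral_past_xi mxi law indep mF F0).
have [_ <-] := has_meanD (has_meanZ (1 - (pw_p p k)^-1) hm)
  (has_mean_cst P (D / pw_p p k ^+ 2)).
have w1 : 1 <= (pw_p p k : R) := pw_p_ge1 p k p1.
apply: ge0_le_integral => //.
- by move=> w _; apply: integral_ge0 => y _; exact: F0.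
- exact: (past_measurable_fun mxi (measurable_fun_fubini_tonelli_F F mF F0)).
- apply/measurable_EFinP; apply: measurable_funD => //.
  by apply: measurable_funM => //; exact: measurable_err.
move=> w _.
have := noise_integral HA (index_iota 1 p) (theta_p p k) (fun t => Z k t w) (drift k w).
move/le_trans; apply; rewrite lee_fin.
have N : (\sum_(1 <= t < p) `|theta_p p k t|) ^+ 2 * sigma ^+ 2 <=
    p`!%:R ^+ 2 * sigma ^+ 2 / pw_p p k ^+ 2.
  have S0 : 0 <= \sum_(1 <= t < p) `|theta_p p k t : R| by apply: sumr_ge0.
  rewrite [leRHS]mulrAC -exprVn -[X in _ <= X * _]exprMn ler_wpM2r ?sqr_ge0 // lerXn2r ?nnegrE //.
    by rewrite divr_ge0 // (le_trans ler01).
  exact: (sum_extrap_weight_le p _ (ltnW p1) w1).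
apply: le_trans (lerD (sfom_drift_le p1 HB (m0 k w)) N) _.
by rewrite -addrA -mulrDl.
Qed.

Lemma err_means : exists e : nat -> R,
  (forall k, has_mean P (fun w => enorm (err k w) ^+ 2) (e k)) /\
  e 0%N <= sigma ^+ 2 /\
  forall k, e k.+1 <= (1 - (pw_p p k)^-1) * e k + D / pw_p p k ^+ 2.
Proof.
(* Defined by the integral and not chosen from existence lemmas, so that consecutive recursion steps
   speak of the same numbers. *)
pose e k := fine (\int[P]_w (enorm (err k w) ^+ 2)%:E)%E.
have eE k m : has_mean P (fun w => enorm (err k w) ^+ 2) m -> e k = m.
  by case=> _ h; rewrite /e h.
have he k : has_mean P (fun w => enorm (err k w) ^+ 2) (e k).
  elim: k => [|k IH].
    by have [m _ h] := err_mean0; rewrite (eE _ _ h).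
  by have [m _ h] := err_meanS IH; rewrite (eE _ _ h).
exists e; split => //; split.
  by have [m ? h] := err_mean0; rewrite (eE _ _ h).
by move=> k; have [m ? h] := err_meanS (he k); rewrite (eE _ _ h).
Qed.

Lemma has_mean_mono (g1 g2 : Omega -> R) (a1 a2 : R) :
  has_mean P g1 a1 -> has_mean P g2 a2 -> (forall w, g1 w <= g2 w) -> a1 <= a2.
Proof.
move=> [i1 e1] [i2 e2] g12; rewrite -lee_fin -e1 -e2.
by apply: le_integral => // w _; rewrite lee_fin.
Qed.

Lemma grad_means : exists g : nat -> R,
  (forall k, has_mean P (fun w => enorm (grad f (X k w))) (g k)) /\
  (forall k, 0 <= g k) /\
  forall K, \sum_(k < K) eta_p p k * g k <= (f x0 - flow + p%:R * sigma ^+ 2) +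
    (2 + L1 / 2 + 3 / 2 * D) * \sum_(k < K) ((k + p)%:R)^-1.
Proof.
have [fl [L10 [fL [s0 _]]]] := HA.
have [_ [Cf [Lp0 _]]] := HB.
have [e [he [e0 eS]]] := err_means.
have ege0 k : 0 <= e k.
  by apply: (has_mean_mono (has_mean_cst P 0) (he k)) => w; exact: sqr_ge0.
pose S K : R := \sum_(k < K) ((k + p)%:R)^-1.
pose B K w := f x0 - flow + (2 + L1 / 2) * S K +
  \sum_(k < K) 2^-1 * (pot_p p k / pw_p p k) * enorm (err k w) ^+ 2.
pose b K := f x0 - flow + (2 + L1 / 2) * S K +
  \sum_(k < K) 2^-1 * (pot_p p k / pw_p p k) * e k.
have hb K : has_mean P (B K) (b K).
  apply: has_meanD; first exact: has_mean_cst.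
  exact: has_mean_sum.
have BP K w : \sum_(k < K) eta_p p k * enorm (grad f (X k w)) <= B K w.
  exact: (sfom_path_sum p1 K Cf (ltW L10) fL fl (fun k => m0 k w)).
(* Finiteness comes from the pathwise inequality up to [k+1], whose last summand on the left is at
   most [B k.+1], a function with a mean. *)
have hg k : exists m, has_mean P (fun w => enorm (grad f (X k w))) m.
  have ek : 0 < (eta_p p k : R) := eta_p_gt0 p k p1.
  have hbk := has_meanZ (eta_p p k)^-1 (hb k.+1).
  have mg : measurable_fun setT (fun w => enorm (grad f (X k w))).
    exact: (past_measurable_fun mxi (@measurable_enorm_grad k)).
  have g0 w : 0 <= enorm (grad f (X k w)) by exact: enorm_ge0.
  have [|m _ hm] := @has_mean_ge0 _ _ _ P _ ((eta_p p k)^-1 * b k.+1) mg g0.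
    have [ib <-] := hbk; apply: ge0_le_integral => //.
    - by move=> w _; rewrite lee_fin.
    - exact/measurable_EFinP.
    - exact: measurable_int ib.
    - move=> w _; rewrite lee_fin ler_pdivlMl //.
      apply: le_trans (BP k.+1 w); rewrite big_ord_recr /= lerDr.
      apply: sumr_ge0 => i _; rewrite mulr_ge0 ?enorm_ge0 //.
      by rewrite ltW // eta_p_gt0.
  by exists m.
have /choice[g gm] := hg.
exists g; split => //; split.
  move=> k; apply: (has_mean_mono (has_mean_cst P 0) (gm k)) => w.
  exact: enorm_ge0.
move=> K.
have hs := has_mean_sum (index_enum 'I_K) (fun k : 'I_K => eta_p p k) (fun k => gm k).
have D0 : 0 <= D.
  by rewrite /D addr_ge0 ?mulr_ge0 ?exprn_ge0 ?(ltW Lp0) ?(ltW s0).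
have := has_mean_mono hs (hb K) (BP K).
have := @potential_sum R p e (sigma ^+ 2) D K p1 ege0 D0 e0 eS.
rewrite -/(S K) /b; set T := \sum_(_ < _) 2^-1 * _ * _.
lra.
Qed.

(** Where the index equals [j], the integrand is the gradient norm at [x^j], a function of the
    samples before [j], and the event is independent of these. *)
Lemma integral_random_index (K : nat) (iota : Omega -> nat) (g : nat -> R) :
  (1 <= K)%N -> (forall j, measurable (iota @^-1` [set j])) ->
  (forall j, (j < K)%N -> P (iota @^-1` [set j]) = (K%:R^-1)%:E) ->
  (forall (B : set nat) (s : seq nat) (A : nat -> set Xi),
    (forall k, measurable (A k)) ->
    P (iota @^-1` B `&` \bigcap_(k in [set j | j \in s]) (xi k @^-1` A k)) =
    (P (iota @^-1` B) * P (\bigcap_(k in [set j | j \in s]) (xi k @^-1` A k)))%E) ->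
  (forall k, has_mean P (fun w => enorm (grad f (X k w))) (g k)) ->
  (\int[P]_w (enorm (grad f (X (iota w) w)))%:E =
   (K%:R^-1 * \sum_(k < K) g k)%:E)%E.
Proof.
move=> K1 mI PI indI hg.
pose I j := iota @^-1` [set j].
pose h k w := enorm (grad f (X k w)).
have tI : trivIset setT I.
  apply/trivIsetP => i j _ _ ij; apply/seteqP; split => // w [/= wi wj].
  by move: ij; rewrite -wi -wj eqxx.
have UI : \bigcup_j I j = setT.
  by apply/seteqP; split => // w _; exists (iota w).
(* The first [K] values already carry mass [K] times [1/K], that is 1. *)
have P0 j : (K <= j)%N -> P (I j) = 0%E.
  move=> Kj.
  have PIj : P (I j) \is a fin_num by apply: fin_num_measure; exact: mI.
  have : (P (\big[setU/set0]_(i < j.+1) I i) <= 1)%E.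
    by apply: probability_le1; apply: bigsetU_measurable => i _; exact: mI.
  rewrite measure_bigsetU // big_ord_recr /= -(big_mkord xpredT (fun i => P (I i))).
  rewrite (@big_cat_nat _ _ _ K) //=.
  have -> : (\sum_(0 <= i < K) P (I i) = 1%:E)%E.
    rewrite big_mkord (eq_bigr (fun=> (K%:R^-1)%:E)); last by move=> i _; exact: PI.
    rewrite sumEFin sumr_const card_ord; congr (_%:E).
    by rewrite -[LHS]mulr_natr mulVf // pnatr_eq0 -lt0n.
  move=> h1; apply/eqP; rewrite eq_le measure_ge0 andbT.
  have y0 : (0 <= \sum_(K <= i < j) P (I i))%E by apply: sume_ge0.
  have : (1%:E + P (I j) <= 1%:E)%E.
    by apply: le_trans h1; rewrite leeD2r // leeDl.
  by rewrite -(fineK PIj) -EFinD !lee_fin gerDl.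
have hI j : (\int[P]_(w in I j) (h (iota w) w)%:E = P (I j) * (g j)%:E)%E.
  have [_ <-] := hg j.
  rewrite -(integral_past_event mxi (k := j) (mI j)); first last.
  - by move=> w; exact: enorm_ge0.
  - exact: measurable_enorm_grad.
  - move=> A [C mC ->]; rewrite setIC /I indI // muleC //.
  by apply: eq_integral => w; rewrite inE => /= ->.
have mh : measurable_fun (\bigcup_j I j) (fun w => (h (iota w) w)%:E).
  apply/measurable_fun_bigcup => // j.
  apply: (@eq_measurable_fun _ _ _ _ _ (fun w => (h j w)%:E)).
    by move=> w; rewrite inE => /= ->.
  apply: measurable_funTS; apply/measurable_EFinP.
  exact: (past_measurable_fun mxi (@measurable_enorm_grad j)).
rewrite -UI ge0_integral_bigcup //; last first.
  by move=> w _; rewrite lee_fin enorm_ge0.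
under eq_eseriesr do rewrite hI.
rewrite (nneseries_split 0 K); last first.
  move=> k _; rewrite mule_ge0 // lee_fin.
  by apply: (has_mean_mono (has_mean_cst P 0) (hg k)) => w; exact: enorm_ge0.
rewrite add0n eseries0 ?adde0; last by move=> i Ki _; rewrite P0 // mul0e.
rewrite big_mkord mulr_sumr -sumEFin; apply: eq_bigr => i _.
by rewrite PI // EFinM.
Qed.

End Convergence.

Theorem theorem3p8
  (R : realType) (n : nat)
  (d : measure_display) (Xi : measurableType d) (mu : probability Xi R)
  (dO : measure_display) (Omega : measurableType dO) (P : probability Omega R)
  (f : 'rV[R]_n -> R) (G : 'rV[R]_n -> Xi -> 'rV[R]_n)
  (flow L1 sigma Lp : R) (p : nat) (x0 : 'rV[R]_n)
  (xi : nat -> Omega -> Xi) :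
  AssumptionA f G mu flow L1 sigma ->
  AssumptionB p f Lp ->
  G_measurable G ->
  (* xi^0, xi^1, ... are independent samples of xi (law mu) *)
  (forall k, measurable_fun setT (xi k)) ->
  (forall k (A : set Xi), measurable A -> P (xi k @^-1` A) = mu A) ->
  (forall (s : seq nat) (A : nat -> set Xi), uniq s ->
     (forall k, measurable (A k)) ->
     P (\bigcap_(k in [set j | j \in s]) (xi k @^-1` A k)) =
     (\prod_(k <- s) P (xi k @^-1` A k))%E) ->
  (* m^k <> 0 (implicitly assumed in Algorithm 1) *)
  (forall k w, sfom_m G x0 (eta_p p) p.-1 (gam_p p) (theta_p p)
                  (fun j => xi j w) k != 0) ->
  forall eps : R, 0 < eps < 1 ->
  forall (K : nat) (iota : Omega -> nat),
    (1 <= K)%N ->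
    (* iota_K uniform on {0,...,K-1} *)
    (forall j, measurable (iota @^-1` [set j])) ->
    (forall j, (j < K)%N -> P (iota @^-1` [set j]) = (K%:R^-1)%:E) ->
    (* iota_K independent of the algorithm's randomness *)
    (forall (B : set nat) (s : seq nat) (A : nat -> set Xi),
       (forall k, measurable (A k)) ->
       P (iota @^-1` B `&` \bigcap_(k in [set j | j \in s]) (xi k @^-1` A k)) =
       (P (iota @^-1` B) * P (\bigcap_(k in [set j | j \in s]) (xi k @^-1` A k)))%E) ->
    let c := (6 * p + 2)%:R * M_p p (f x0) flow sigma L1 Lp / (p%:R * eps) in
    Num.max ((c * ln c) `^ ((3 * p + 1)%:R / p%:R)) (2 * p)%:R <= K%:R ->
    (\int[P]_w (enorm (grad f (sfom_x G x0 (eta_p p) p.-1 (gam_p p) (theta_p p)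
                                  (fun j => xi j w) (iota w))))%:E
       <= eps%:E)%E.
Proof.
move=> HA HB HG mxi law indep m0 eps /andP[eps0 _] K iota K1 mI PI indI c.
rewrite ge_max ler_nat => /andP[cK pK].
have [fl [L10 [_ [s0 _]]]] := HA; have [p1 [_ [Lp0 _]]] := HB.
have [g [gm [g0 gs]]] := grad_means (x0 := x0) HA HB HG mxi law indep m0.
rewrite (integral_random_index HA HG mxi K1 mI PI indI gm) lee_fin.
move: gs; set D := _ + _ * sigma ^+ 2; set A := _ + p%:R * _; set B := _ + 3 / 2 * D.
move=> gs.
have Q0 : 0 <= p%:R ^+ (2 * p) * Lp ^+ 2 by rewrite mulr_ge0 ?exprn_ge0 ?(ltW Lp0).
have F0 : 0 <= p`!%:R ^+ 2 * sigma ^+ 2 by rewrite mulr_ge0 ?exprn_ge0 ?(ltW s0).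
have A0 : 0 <= A by rewrite addr_ge0 ?subr_ge0 // mulr_ge0 // sqr_ge0.
have p2 : 2 <= p%:R :> R by rewrite ler_nat.
have B0 : 2 <= B by rewrite /B /D -mulrA; lra.
(* Beyond [A], the terms of [A + 2B] are [4], [L1], [12 p^(2p) Lp^2] and [3 (p!)^2 sigma^2]. They
   are compared with [2(p+1) >= 6], [3 L1 / 2] and the coefficients 64 and 32 in [M_p / 4]. *)
have ABM : 4 * (A + 2 * B) <= M_p p (f x0) flow sigma L1 Lp.
  have L0 : 0 <= 7 * Lp ^+ 2 / p`!%:R ^+ 2.
    by rewrite mulr_ge0 ?invr_ge0 ?mulr_ge0 ?exprn_ge0 ?(ltW Lp0).
  by rewrite /M_p /A /B /D -!(mulrA _ (_ ^+ _) (_ ^+ _)); lra.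
apply: (average_le p1 pK g0 A0 _ _ ABM eps0 (gs K) cK).
- by apply: le_trans B0.
- by apply: lt_le_trans ABM; lra.
Qed.
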